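(* Let $\Gamma$ be an abelian group and let $A$ be a $\Gamma$-graded $*$-field which has enough unitaries and such that $A_0$ is 2-proper and $*$-pythagorean. If $R$ and $S$ are (possibly non-unital) graded ultramatricial $*$-algebras over $A$, then $R$ and $S$ are isomorphic as graded rings if and only if $R$ and $S$ are isomorphic as graded $*$-algebras over $A$. If the involutive structure is not considered and $A$ is any $\Gamma$-graded field, then two graded ultramatricial algebras over $A$ are isomorphic as graded rings if and only if they are isomorphic as graded $A$-algebras.
   Context: A $\Gamma$-graded ring is a ring $A=\bigoplus_{\gamma\in\Gamma}A_\gamma$ with $A_\gamma A_\delta\subseteq A_{\gamma+\delta}$. A graded field is a commutative graded ring in which every nonzero homogeneous element is invertible. A $\Gamma$-graded $*$-ring is a graded ring with involution (additive anti-automorphism of order two) with $A_\gamma^*\subseteq A_{-\gamma}$; a graded $*$-field is a graded field that is a graded $*$-ring. $A$ has enough unitaries if every nonzero component $A_\gamma$ contains an element $a$ with $aa^*=a^*a=1$. A $*$-ring $B$ is 2-proper if $aa^*+bb^*=0$ implies $a=b=0$, and $*$-pythagorean if for all $a,b\in B$ there is $c\in B$ with $aa^*+bb^*=cc^*$. For $\overline\gamma\in\Gamma^n$, $\mathbb{M}_n(A)(\overline\gamma)$ is $\mathbb{M}_n(A)$ graded so that its $\delta$-component consists of the matrices $(a_{ij})$ with $a_{ij}\in A_{\delta+\gamma_j-\gamma_i}$, with involution $(a_{ij})^*=(a_{ji}^* )$ when $A$ has an involution. A graded matricial ($*$-)algebra over $A$ is a finite direct sum of algebras $\mathbb{M}_{n_i}(A)(\overline\gamma_i)$,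 $\overline\gamma_i\in\Gamma^{n_i}$ (with coordinatewise $*$-transpose). A graded ultramatricial ($*$-)algebra over $A$ is a graded ($*$-)algebra isomorphic to the direct limit of a sequence of graded matricial ($*$-)algebras with graded $A$-algebra ($*$-)homomorphisms, not necessarily unital, as connecting maps. Isomorphisms of graded rings preserve the graded components; isomorphisms of graded algebras are moreover $A$-linear; isomorphisms of graded $*$-algebras moreover commute with $*$. *)

(* Defs.v *)
From HB Require Import structures.
From mathcomp Require Import all_boot all_order all_algebra.
(* boolp is only used to decide the relation whose quotient is a direct limit. *)
From mathcomp Require Import boolp.

Set Implicit Arguments.
Unset Strict Implicit.
Unset Printing Implicit Defensive.

Import GRing.Theory.
Local Open Scope ring_scope.

(* [homog_span] and [homog_direct] say that V is the sum, resp. that the sum is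
   direct, of the subgroups V_g = {x | homog g x}. *)
Record grading (G V : zmodType) := Grading {
  homog :> G -> V -> Prop;
  homog0 : forall g, homog g 0;
  homogB : forall g x y, homog g x -> homog g y -> homog g (x - y);
  homog_span : forall x, exists s : seq V,
    (forall y, y \in s -> exists g, homog g y) /\ x = \sum_(y <- s) y;
  homog_direct : forall (s : seq G) (c : G -> V),
    uniq s -> (forall g, homog g (c g)) -> \sum_(g <- s) c g = 0 ->
    forall g, g \in s -> c g = 0
}.

Record ring_grading (G : zmodType) (A : pzRingType) := RingGrading {
  rg_grading :> grading G A;
  rg_homogM : forall g h (a b : A),
    rg_grading g a -> rg_grading h b -> rg_grading (g + h) (a * b)
}.

Definition graded_field (G : zmodType) (A : comPzRingType)
    (gA : ring_grading G A) : Prop :=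
  forall g (a : A), gA g a -> a <> 0 -> exists b, a * b = 1.

Record ring_involution (G : zmodType) (A : pzRingType)
    (gA : ring_grading G A) := RingInvolution {
  rstar :> A -> A;
  rstarK : involutive rstar;
  rstarD : {morph rstar : x y / x + y};
  rstarM : forall x y, rstar (x * y) = rstar y * rstar x;
  rstar_homog : forall g x, gA g x -> gA (- g) (rstar x)
}.

Definition enough_unitaries (G : zmodType) (A : pzRingType)
    (gA : ring_grading G A) (sA : ring_involution gA) : Prop :=
  forall g, (exists a, gA g a /\ a <> 0) ->
    exists a, [/\ gA g a, a * sA a = 1 & sA a * a = 1].

(* 2-properness and the *-pythagorean property of the *-subring {a | B a}. *)
Definition two_proper_on (A : pzRingType) (star : A -> A) (B : A -> Prop) :=
  forall a b, B a -> B b -> a * star a + b * star b = 0 -> a = 0 /\ b = 0.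

Definition star_pythagorean_on (A : pzRingType) (star : A -> A)
    (B : A -> Prop) :=
  forall a b, B a -> B b ->
    exists2 c, B c & a * star a + b * star b = c * star c.

(* No unit is required: the multiplication is not that of a ring structure of
   the library, whose rings are unital. *)
Record galg (G : zmodType) (A : comPzRingType) (gA : ring_grading G A) :=
  GAlg {
    galg_sort :> lmodType A;
    gmul : galg_sort -> galg_sort -> galg_sort;
    gmulA : associative gmul;
    gmulDl : left_distributive gmul +%R;
    gmulDr : right_distributive gmul +%R;
    gscaleAl : forall a x y, a *: gmul x y = gmul (a *: x) y;
    gscaleAr : forall a x y, a *: gmul x y = gmul x (a *: y);
    ghomog : grading G galg_sort;
    ghomogM : forall g h x y,
      ghomog g x -> ghomog h y -> ghomog (g + h) (gmul x y);
    ghomogZ : forall g h a x,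
      gA g a -> ghomog h x -> ghomog (g + h) (a *: x)
  }.

Local Notation "x ** y" := (gmul x y) (at level 40, left associativity).

Record gsalg (G : zmodType) (A : comPzRingType) (gA : ring_grading G A)
    (sA : ring_involution gA) := GSAlg {
  gsalg_galg :> galg gA;
  gstar : gsalg_galg -> gsalg_galg;
  gstarK : involutive gstar;
  gstarD : {morph gstar : x y / x + y};
  gstarM : forall x y, gstar (x ** y) = gstar y ** gstar x;
  gstarZ : forall a x, gstar (a *: x) = sA a *: gstar x;
  gstar_homog : forall g x, ghomog _ g x -> ghomog _ (- g) (gstar x)
}.

Section Morphisms.
Variables (G : zmodType) (A : comPzRingType) (gA : ring_grading G A).

Definition graded_ring_hom (R S : galg gA) (f : R -> S) : Prop :=
  [/\ {morph f : x y / x + y}, {morph f : x y / x ** y}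
    & forall g x, ghomog R g x -> ghomog S g (f x)].

Definition graded_alg_hom (R S : galg gA) (f : R -> S) : Prop :=
  graded_ring_hom f /\ (forall a x, f (a *: x) = a *: f x).

Definition graded_star_alg_hom (sA : ring_involution gA) (R S : gsalg sA)
    (f : R -> S) : Prop :=
  graded_alg_hom f /\ {morph f : x / gstar x}.

Definition graded_ring_isomorphic (R S : galg gA) : Prop :=
  exists2 f : R -> S, bijective f & graded_ring_hom f.

Definition graded_alg_isomorphic (R S : galg gA) : Prop :=
  exists2 f : R -> S, bijective f & graded_alg_hom f.

Definition graded_star_alg_isomorphic (sA : ring_involution gA)
    (R S : gsalg sA) : Prop :=
  exists2 f : R -> S, bijective f & graded_star_alg_hom f.

End Morphisms.

Section Spanned.
Variables (G V : zmodType) (hg : G -> V -> Prop).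

Definition spanned x := exists s : seq V,
  (forall y, y \in s -> exists g, hg g y) /\ x = \sum_(y <- s) y.

Lemma spanned0 : spanned 0.
Proof. by exists [::]; split => //; rewrite big_nil. Qed.

Lemma spannedD x y : spanned x -> spanned y -> spanned (x + y).
Proof.
move=> [s [hs ->]] [t [ht ->]]; exists (s ++ t); rewrite big_cat; split=> // z.
by rewrite mem_cat => /orP[/hs|/ht].
Qed.

Lemma spanned_sum (I : Type) (r : seq I) (P : pred I) (F : I -> V) :
  (forall i, P i -> spanned (F i)) -> spanned (\sum_(i <- r | P i) F i).
Proof. by move=> h; apply: big_ind => //; [exact: spanned0|exact: spannedD]. Qed.

Lemma spanned1 g x : hg g x -> spanned x.
Proof.
move=> hx; exists [:: x]; rewrite big_seq1; split=> // y.
by rewrite inE => /eqP ->; exists g.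
Qed.

End Spanned.

Lemma spanned_map (G V W : zmodType) (hV : grading G V) (hW : G -> W -> Prop)
    (f : V -> W) : f 0 = 0 -> {morph f : x y / x + y} ->
  (forall g x, hV g x -> exists h, hW h (f x)) -> forall x, spanned hW (f x).
Proof.
move=> f0 fD fh x; have [s [hs ->]] := homog_span hV x.
rewrite (big_morph f fD f0) big_seq; apply: spanned_sum => y ys.
by have [g /fh [h hh]] := hs _ ys; exact: spanned1 hh.
Qed.

(* The algebra M_n(A)(gamma) *)
Section GradedMatrix.
Variables (G : zmodType) (A : comPzRingType) (gA : ring_grading G A).
Variables (n : nat) (gamma : 'I_n -> G).

Definition mx_homog (d : G) (M : 'M[A]_n) : Prop :=
  forall i j, gA (d + gamma j - gamma i) (M i j).

Lemma mx_homog0 d : mx_homog d 0.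
Proof. by move=> i j; rewrite mxE; exact: homog0. Qed.

Lemma mx_homogB d M N : mx_homog d M -> mx_homog d N -> mx_homog d (M - N).
Proof. by move=> hM hN i j; rewrite !mxE; exact: homogB. Qed.

Lemma mx_homog_span M : spanned mx_homog M.
Proof.
rewrite (matrix_sum_delta M); apply: spanned_sum => i _; apply: spanned_sum => j _.
apply: (@spanned_map _ _ _ gA _ (fun a => a *: delta_mx i j)).
- by rewrite scale0r.
- by move=> x y; rewrite scalerDl.
move=> g x gx; exists (g - gamma j + gamma i) => i' j'; rewrite !mxE.
case: eqP => [->|_] /=; last by rewrite mulr0; exact: homog0.
case: eqP => [->|_] /=; last by rewrite mulr0; exact: homog0.
by rewrite mulr1 addrAC addrK subrK.
Qed.

Lemma mx_homog_direct (s : seq G) (c : G -> 'M[A]_n) :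
  uniq s -> (forall g, mx_homog g (c g)) -> \sum_(g <- s) c g = 0 ->
  forall g, g \in s -> c g = 0.
Proof.
move=> us hc sc0 g gs; apply/matrixP => i j; rewrite mxE.
pose t := gamma j - gamma i.
have tI : injective (+%R^~ t) by exact: addIr.
have := @homog_direct _ _ gA [seq h + t | h <- s] (fun h => c (h - t) i j).
rewrite map_inj_uniq // => /(_ us) H.
have := H _ _ (g + t); rewrite addrK; apply.
- by move=> h; have := hc (h - t) i j; rewrite -addrA subrK.
- rewrite big_map; have /matrixP/(_ i j) := sc0; rewrite summxE mxE => sc0ij.
  by rewrite -[RHS]sc0ij; apply: eq_bigr => h _; rewrite addrK.
- exact: map_f.
Qed.

Definition mx_grading : grading G 'M[A]_n :=
  Grading mx_homog0 mx_homogB mx_homog_span mx_homog_direct.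

Lemma mx_homogM g h (M N : 'M[A]_n) :
  mx_grading g M -> mx_grading h N -> mx_grading (g + h) (M *m N).
Proof.
move=> hM hN i j; rewrite mxE; apply: big_ind => [|x y hx hy|k _].
- exact: homog0.
- rewrite -[y]opprK; apply: homogB => //.
  by rewrite -[- y]sub0r; apply: homogB => //; exact: homog0.
have := rg_homogM (hM i k) (hN k j); congr (gA _ _).
by rewrite [g + _ - _]addrAC addrACA subrr addr0 addrACA addrA addrAC.
Qed.

Lemma mx_homogZ g h a (M : 'M[A]_n) :
  gA g a -> mx_grading h M -> mx_grading (g + h) (a *: M).
Proof.
by move=> ha hM i j; rewrite mxE -!addrA; apply: rg_homogM => //; rewrite addrA.
Qed.

Definition mx_galg : galg gA :=
  @GAlg G A gA 'M[A]_n (@mulmx A n n n) (@mulmxA A n n n n)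
    (fun M N P => mulmxDl M N P) (fun M N P => mulmxDr M N P)
    (fun a M N => scalemxAl a M N) (fun a M N => scalemxAr a M N)
    mx_grading mx_homogM mx_homogZ.

Variable sA : ring_involution gA.

Definition mx_star (M : mx_galg) : mx_galg := \matrix_(i, j) sA (M j i).

Lemma rstar0 : sA 0 = 0.
Proof. by apply: (addrI (sA 0)); rewrite -rstarD !addr0. Qed.

Lemma mx_starK : involutive mx_star.
Proof. by move=> M; apply/matrixP => i j; rewrite !mxE rstarK. Qed.

Lemma mx_starD : {morph mx_star : M N / M + N}.
Proof. by move=> M N; apply/matrixP => i j; rewrite !mxE rstarD. Qed.

Lemma mx_starM (M N : mx_galg) : mx_star (M ** N) = mx_star N ** mx_star M.
Proof.
apply/matrixP => i j; rewrite !mxE (big_morph sA (@rstarD _ _ _ sA) rstar0).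
by apply: eq_bigr => k _; rewrite !mxE rstarM.
Qed.

Lemma mx_starZ a (M : mx_galg) : mx_star (a *: M) = sA a *: mx_star M.
Proof. by apply/matrixP => i j; rewrite !mxE rstarM mulrC. Qed.

Lemma mx_star_homog g (M : mx_galg) :
  ghomog _ g M -> ghomog _ (- g) (mx_star M).
Proof.
move=> hM i j; rewrite mxE; have := rstar_homog sA (hM j i).
by rewrite opprB opprD addrCA addrA.
Qed.

Definition mx_gsalg : gsalg sA :=
  GSAlg mx_starK mx_starD mx_starM mx_starZ mx_star_homog.

End GradedMatrix.

Section DirectSum.
Variables (G : zmodType) (A : comPzRingType) (gA : ring_grading G A).
Variables (k : nat).

Definition dsum (B : 'I_k -> galg gA) : Type := {dffun forall i : 'I_k, B i}.

Section Algebra.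
Variable B : 'I_k -> galg gA.

HB.instance Definition _ := Choice.on (dsum B).

Implicit Types x y z : dsum B.

Definition dsum0 : dsum B := [ffun i => 0].
Definition dsum_opp x : dsum B := [ffun i => - x i].
Definition dsum_add x y : dsum B := [ffun i => x i + y i].
Definition dsum_scale a x : dsum B := [ffun i => a *: x i].
Definition dsum_mul x y : dsum B := [ffun i => x i ** y i].

Fact dsum_addA : associative dsum_add.
Proof. by move=> x y z; apply/ffunP => i; rewrite !ffunE addrA. Qed.
Fact dsum_addC : commutative dsum_add.
Proof. by move=> x y; apply/ffunP => i; rewrite !ffunE addrC. Qed.
Fact dsum_add0 : left_id dsum0 dsum_add.
Proof. by move=> x; apply/ffunP => i; rewrite !ffunE add0r. Qed.
Fact dsum_addN : left_inverse dsum0 dsum_opp dsum_add.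
Proof. by move=> x; apply/ffunP => i; rewrite !ffunE addNr. Qed.

HB.instance Definition _ :=
  GRing.isZmodule.Build (dsum B) dsum_addA dsum_addC dsum_add0 dsum_addN.

Fact dsum_scaleA a b x : dsum_scale a (dsum_scale b x) = dsum_scale (a * b) x.
Proof. by apply/ffunP => i; rewrite !ffunE scalerA. Qed.
Fact dsum_scale1 : left_id 1 dsum_scale.
Proof. by move=> x; apply/ffunP => i; rewrite !ffunE scale1r. Qed.
Fact dsum_scaleDr : right_distributive dsum_scale +%R.
Proof. by move=> a x y; apply/ffunP => i; rewrite !ffunE scalerDr. Qed.
Fact dsum_scaleDl x : {morph dsum_scale^~ x : a b / a + b}.
Proof. by move=> a b; apply/ffunP => i; rewrite !ffunE scalerDl. Qed.

HB.instance Definition _ := GRing.Zmodule_isLmodule.Build A (dsum B)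
  dsum_scaleA dsum_scale1 dsum_scaleDr dsum_scaleDl.

Lemma dsumDE x y i : (x + y) i = x i + y i.
Proof. by rewrite ffunE. Qed.
Lemma dsum0E i : (0 : dsum B) i = 0.
Proof. by rewrite ffunE. Qed.
Lemma dsumNE x i : (- x) i = - x i.
Proof. by rewrite ffunE. Qed.
Lemma dsumZE a x i : (a *: x) i = a *: x i.
Proof. by rewrite ffunE. Qed.
Lemma dsum_sumE (I : Type) (r : seq I) (P : pred I) (F : I -> dsum B) i :
  (\sum_(j <- r | P j) F j) i = \sum_(j <- r | P j) F j i.
Proof.
by apply: (big_morph (fun x : dsum B => x i)) => [x y|]; rewrite ?dsumDE ?dsum0E.
Qed.

Definition dsum_homog (g : G) x : Prop := forall i, ghomog (B i) g (x i).

Lemma dsum_homog0 g : dsum_homog g 0.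
Proof. by move=> i; rewrite dsum0E; exact: homog0. Qed.

Lemma dsum_homogB g x y :
  dsum_homog g x -> dsum_homog g y -> dsum_homog g (x - y).
Proof. by move=> hx hy i; rewrite dsumDE dsumNE; exact: homogB. Qed.

Definition dsum_in (i : 'I_k) (u : B i) : dsum B :=
  [ffun j => match i =P j with ReflectT e => ecast j (B j) e u | _ => 0 end].

Lemma dsum_in_eq i (u : B i) : dsum_in u i = u.
Proof. by rewrite ffunE; case: eqP => // e; rewrite eq_axiomK. Qed.

Lemma dsum_in_neq i j (u : B i) : i <> j -> dsum_in u j = 0.
Proof. by move=> ne; rewrite ffunE; case: eqP. Qed.

Lemma dsum_homog_span x : spanned dsum_homog x.
Proof.
have -> : x = \sum_i dsum_in (x i).
  apply/ffunP => i; rewrite dsum_sumE (bigD1 i) //= dsum_in_eq big1 ?addr0 //.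
  by move=> j /eqP ne; rewrite dsum_in_neq.
apply: spanned_sum => i _.
apply: (@spanned_map _ _ _ (ghomog (B i)) _ (@dsum_in i)).
- apply/ffunP => j; rewrite dsum0E; case: (i =P j) => [<-|ne].
    by rewrite dsum_in_eq.
  by rewrite dsum_in_neq.
- move=> u v; apply/ffunP => j; rewrite dsumDE; case: (i =P j) => [<-|ne].
    by rewrite !dsum_in_eq.
  by rewrite !dsum_in_neq // addr0.
move=> g u gu; exists g => j; case: (i =P j) => [<-|ne].
  by rewrite dsum_in_eq.
by rewrite dsum_in_neq //; exact: homog0.
Qed.

Lemma dsum_homog_direct (s : seq G) (c : G -> dsum B) :
  uniq s -> (forall g, dsum_homog g (c g)) -> \sum_(g <- s) c g = 0 ->
  forall g, g \in s -> c g = 0.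
Proof.
move=> us hc sc0 g gs; apply/ffunP => i; rewrite dsum0E.
apply: (@homog_direct _ _ (ghomog (B i)) s (fun h => c h i)) => //.
  by move=> h; exact: hc.
by rewrite -dsum_sumE sc0 dsum0E.
Qed.

Definition dsum_grading : grading G (dsum B) :=
  Grading dsum_homog0 dsum_homogB dsum_homog_span dsum_homog_direct.

Fact dsum_mulA : associative dsum_mul.
Proof. by move=> x y z; apply/ffunP => i; rewrite !ffunE gmulA. Qed.
Fact dsum_mulDl : left_distributive dsum_mul +%R.
Proof. by move=> x y z; apply/ffunP => i; rewrite !ffunE gmulDl. Qed.
Fact dsum_mulDr : right_distributive dsum_mul +%R.
Proof. by move=> x y z; apply/ffunP => i; rewrite !ffunE gmulDr. Qed.
Fact dsum_scaleAl a x y : a *: dsum_mul x y = dsum_mul (a *: x) y.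
Proof. by apply/ffunP => i; rewrite !ffunE gscaleAl. Qed.
Fact dsum_scaleAr a x y : a *: dsum_mul x y = dsum_mul x (a *: y).
Proof. by apply/ffunP => i; rewrite !ffunE gscaleAr. Qed.
Fact dsum_homogM g h x y :
  dsum_grading g x -> dsum_grading h y -> dsum_grading (g + h) (dsum_mul x y).
Proof. by move=> hx hy i; rewrite ffunE; exact: ghomogM. Qed.
Fact dsum_homogZ g h a x :
  gA g a -> dsum_grading h x -> dsum_grading (g + h) (a *: x).
Proof. by move=> ha hx i; rewrite dsumZE; exact: ghomogZ. Qed.

Definition dsum_galg : galg gA :=
  @GAlg G A gA (dsum B) dsum_mul dsum_mulA dsum_mulDl dsum_mulDr
    dsum_scaleAl dsum_scaleAr dsum_grading dsum_homogM dsum_homogZ.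

End Algebra.

Section StarAlgebra.
Variables (sA : ring_involution gA) (B : 'I_k -> gsalg sA).

Definition dsum_star (x : dsum_galg B) : dsum_galg B :=
  [ffun i => gstar ((x : dsum B) i)] : dsum B.

Fact dsum_starK : involutive dsum_star.
Proof. by move=> x; apply/ffunP => i; rewrite !ffunE gstarK. Qed.
Fact dsum_starD : {morph dsum_star : x y / x + y}.
Proof. by move=> x y; apply/ffunP => i; rewrite !ffunE gstarD. Qed.
Fact dsum_starM (x y : dsum_galg B) :
  dsum_star (x ** y) = dsum_star y ** dsum_star x.
Proof. by apply/ffunP => i; rewrite !ffunE gstarM. Qed.
Fact dsum_starZ a (x : dsum_galg B) :
  dsum_star (a *: x) = sA a *: dsum_star x.
Proof. by apply/ffunP => i; rewrite !ffunE gstarZ. Qed.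
Fact dsum_star_homog g (x : dsum_galg B) :
  ghomog _ g x -> ghomog _ (- g) (dsum_star x).
Proof. by move=> hx i; rewrite ffunE; exact: gstar_homog. Qed.

Definition dsum_gsalg : gsalg sA :=
  GSAlg dsum_starK dsum_starD dsum_starM dsum_starZ dsum_star_homog.

End StarAlgebra.
End DirectSum.

(* The data (n_1, gamma_1), ..., (n_k, gamma_k) of a matricial algebra; k and
   the n_i may be 0. *)
Record mshape (G : zmodType) := MShape {
  mblocks : nat;
  msize : 'I_mblocks -> nat;
  mshift : forall i, 'I_(msize i) -> G
}.

Definition matricial (G : zmodType) (A : comPzRingType)
    (gA : ring_grading G A) (s : mshape G) : galg gA :=
  dsum_galg (fun i => mx_galg gA (@mshift G s i)).

Definition matricial_star (G : zmodType) (A : comPzRingType)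
    (gA : ring_grading G A) (sA : ring_involution gA) (s : mshape G) :
    gsalg sA :=
  dsum_gsalg (fun i => mx_gsalg (@mshift G s i) sA).

(* Direct limit of a sequence, as the quotient of the disjoint union of the
   terms that identifies elements with equal images in some later term. *)
Record dirseq (G : zmodType) (A : comPzRingType) (gA : ring_grading G A) :=
  DirSeq {
    ds_obj :> nat -> galg gA;
    ds_map : forall n, ds_obj n -> ds_obj n.+1;
    ds_hom : forall n, graded_alg_hom (@ds_map n)
  }.

Section DirectLimit.
Variables (G : zmodType) (A : comPzRingType) (gA : ring_grading G A).
Variable D : dirseq gA.

(* The composite connecting map D n -> D m when n <= m (junk value 0
   otherwise). *)
Fixpoint ds_trans (n m : nat) {struct m} : D n -> D m :=
  match n =P m with
  | ReflectT e => fun x => ecast i (D i) e x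
  | ReflectF _ =>
      match m with
      | 0 => fun=> 0
      | m'.+1 => fun x => ds_map (ds_trans m' x)
      end
  end.

Lemma ds_mapD n : {morph @ds_map _ _ _ D n : x y / x + y}.
Proof. by have [[]] := ds_hom D n. Qed.
Lemma ds_mapM n : {morph @ds_map _ _ _ D n : x y / x ** y}.
Proof. by have [[]] := ds_hom D n. Qed.
Lemma ds_maph n g (x : D n) : ghomog _ g x -> ghomog _ g (ds_map x).
Proof. by have [[_ _ h _]] := ds_hom D n; apply: h. Qed.
Lemma ds_mapZ n a (x : D n) : ds_map (a *: x) = a *: ds_map x.
Proof. by have [_ h] := ds_hom D n; apply: h. Qed.

Lemma ds_trans_id n (x : D n) : ds_trans n x = x.
Proof. by case: n x => [|n] x /=; case: eqP => // e; rewrite eq_axiomK. Qed.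

Lemma ds_transS n m (x : D n) : (n <= m)%N ->
  ds_trans m.+1 x = ds_map (ds_trans m x).
Proof. by move=> le /=; case: eqP => // e; exfalso; move: le; rewrite e ltnn. Qed.

Lemma ds_trans_trans n m p (x : D n) : (n <= m)%N -> (m <= p)%N ->
  ds_trans p (ds_trans m x) = ds_trans p x.
Proof.
move=> nm; elim: p => [|p IH].
  by rewrite leqn0 => /eqP m0; subst m; rewrite ds_trans_id.
rewrite leq_eqVlt => /predU1P[e|]; first by subst m; rewrite ds_trans_id.
rewrite ltnS => mp; rewrite ds_transS // IH // ds_transS //.
exact: leq_trans mp.
Qed.

Section Closure.
Variables (n m : nat) (le : (n <= m)%N).

Lemma ds_trans_ind (P : forall m, D m -> Prop) (x : D n) : P n x ->
  (forall p (y : D p), P p y -> P p.+1 (ds_map y)) -> P m (ds_trans m x).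
Proof.
move=> Px PS; elim: m le => [|p IH].
  by rewrite leqn0 => /eqP n0; subst n; rewrite ds_trans_id.
rewrite leq_eqVlt => /predU1P[e|]; first by subst n; rewrite ds_trans_id.
by rewrite ltnS => np; rewrite ds_transS //; apply/PS/IH.
Qed.

Lemma ds_transD : {morph @ds_trans n m : x y / x + y}.
Proof.
move=> x y; elim: m le => [|p IH].
  by rewrite leqn0 => /eqP n0; subst n; rewrite !ds_trans_id.
rewrite leq_eqVlt => /predU1P[e|]; first by subst n; rewrite !ds_trans_id.
by rewrite ltnS => np; rewrite !ds_transS // IH // ds_mapD.
Qed.

Lemma ds_transM : {morph @ds_trans n m : x y / x ** y}.
Proof.
move=> x y; elim: m le => [|p IH].
  by rewrite leqn0 => /eqP n0; subst n; rewrite !ds_trans_id.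
rewrite leq_eqVlt => /predU1P[e|]; first by subst n; rewrite !ds_trans_id.
by rewrite ltnS => np; rewrite !ds_transS // IH // ds_mapM.
Qed.

Lemma ds_transZ a (x : D n) : ds_trans m (a *: x) = a *: ds_trans m x.
Proof.
elim: m le => [|p IH].
  by rewrite leqn0 => /eqP n0; subst n; rewrite !ds_trans_id.
rewrite leq_eqVlt => /predU1P[e|]; first by subst n; rewrite !ds_trans_id.
by rewrite ltnS => np; rewrite !ds_transS // IH // ds_mapZ.
Qed.

Lemma ds_transh g (x : D n) : ghomog _ g x -> ghomog _ g (ds_trans m x).
Proof.
move=> hx; apply: (@ds_trans_ind (fun m y => ghomog _ g y)) => // p y.
exact: ds_maph.
Qed.

Lemma ds_trans0 : @ds_trans n m 0 = 0.
Proof. by apply: (addrI (ds_trans m (0 : D n))); rewrite -ds_transD !addr0. Qed.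

Lemma ds_transN (x : D n) : ds_trans m (- x) = - ds_trans m x.
Proof. by apply/eqP; rewrite -addr_eq0 -ds_transD addNr ds_trans0. Qed.

End Closure.

Definition dl_rel : rel {n : nat & D n} := fun t u =>
  `[< exists k, [/\ (tag t <= k)%N, (tag u <= k)%N
        & ds_trans k (tagged t) = ds_trans k (tagged u)] >].

Fact dl_rel_refl : reflexive dl_rel.
Proof. by move=> t; apply/asboolP; exists (tag t). Qed.

Fact dl_rel_sym : symmetric dl_rel.
Proof.
by move=> t u; apply/asboolP/asboolP => -[k [h1 h2 h3]]; exists k; split.
Qed.

Fact dl_rel_trans : transitive dl_rel.
Proof.
move=> u t v /asboolP[k [h1 h2 h3]] /asboolP[l [h4 h5 h6]]; apply/asboolP.
have kl := leq_maxl k l; have lk := leq_maxr k l.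
exists (maxn k l); split; [exact: leq_trans kl|exact: leq_trans lk|].
rewrite -(ds_trans_trans _ h1 kl) h3 (ds_trans_trans _ h2 kl).
by rewrite -(ds_trans_trans _ h5 lk) -h6 (ds_trans_trans _ h4 lk).
Qed.

Canonical dl_equiv :=
  EquivRel dl_rel dl_rel_refl dl_rel_sym dl_rel_trans.

Definition dirlim_sort := {eq_quot dl_equiv}%qT.
HB.instance Definition _ := Choice.on dirlim_sort.
HB.instance Definition _ := EqQuotient.on dirlim_sort.

Local Notation L := dirlim_sort.

(* The canonical map D n -> L *)
Definition dl_in n (x : D n) : L := (\pi_L (existT (fun n => D n : Type) n x))%qT.

Lemma dl_in_eq n m (x : D n) (y : D m) :
  dl_in x = dl_in y <->
  exists k, [/\ (n <= k)%N, (m <= k)%N & ds_trans k x = ds_trans k y].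
Proof.
split=> [/eqquotP/asboolP //|h]; apply/eqquotP/asboolP; exact: h.
Qed.

Lemma dl_in_trans n m (x : D n) : (n <= m)%N -> dl_in (ds_trans m x) = dl_in x.
Proof.
by move=> le; apply/dl_in_eq; exists m; split=> //; rewrite ds_trans_id.
Qed.

Lemma dl_inP (x : L) : exists n, exists a : D n, x = dl_in a.
Proof.
by exists (tag (repr x)), (tagged (repr x)); rewrite /dl_in; case E: (repr x);
   rewrite /= -E reprK.
Qed.

Lemma dl_inP2 (x y : L) :
  exists n, exists a : D n, exists b : D n, x = dl_in a /\ y = dl_in b.
Proof.
have [n [a ->]] := dl_inP x; have [m [b ->]] := dl_inP y.
exists (maxn n m), (ds_trans _ a), (ds_trans _ b).
by rewrite !dl_in_trans // ?leq_maxl ?leq_maxr.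
Qed.

Lemma dl_inP3 (x y z : L) : exists n, exists a : D n, exists b : D n,
  exists c : D n, [/\ x = dl_in a, y = dl_in b & z = dl_in c].
Proof.
have [n [a [b [-> ->]]]] := dl_inP2 x y; have [m [c ->]] := dl_inP z.
exists (maxn n m), (ds_trans _ a), (ds_trans _ b), (ds_trans _ c).
by rewrite !dl_in_trans // ?leq_maxl ?leq_maxr.
Qed.

Definition dl_op2 (op : forall n, D n -> D n -> D n) (x y : L) : L :=
  let k := maxn (tag (repr x)) (tag (repr y)) in
  dl_in (op k (ds_trans k (tagged (repr x))) (ds_trans k (tagged (repr y)))).

Definition dl_op1 (op : forall n, D n -> D n) (x : L) : L :=
  dl_in (op _ (tagged (repr x))).

Lemma dl_op1E op n (x : D n) :
  (forall n m (x : D n), (n <= m)%N ->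
    ds_trans m (op n x) = op m (ds_trans m x)) ->
  dl_op1 op (dl_in x) = dl_in (op n x).
Proof.
move=> opP; rewrite /dl_op1; set t := repr _.
have : dl_in (tagged t) = dl_in x.
  by rewrite -[RHS]reprK -/t /dl_in; case: (t).
move=> /dl_in_eq[k [h1 h2 h3]]; apply/dl_in_eq; exists k.
by split=> //; rewrite !opP // h3.
Qed.

Lemma dl_op2E op n (x y : D n) :
  (forall n m (x y : D n), (n <= m)%N ->
    ds_trans m (op n x y) = op m (ds_trans m x) (ds_trans m y)) ->
  dl_op2 op (dl_in x) (dl_in y) = dl_in (op n x y).
Proof.
move=> opP; rewrite /dl_op2; set t := repr (dl_in x); set u := repr (dl_in y).
have : dl_in (tagged t) = dl_in x.
  by rewrite -[RHS]reprK -/t /dl_in; case: (t).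
have : dl_in (tagged u) = dl_in y.
  by rewrite -[RHS]reprK -/u /dl_in; case: (u).
move=> /dl_in_eq[l [h4 h5 h6]] /dl_in_eq[k [h1 h2 h3]]; apply/dl_in_eq.
set j := maxn (tag t) (tag u); exists (maxn j (maxn k l)).
have jm := leq_maxl j (maxn k l).
have km : (k <= maxn j (maxn k l))%N by rewrite !leq_max leqnn orbT.
have lm : (l <= maxn j (maxn k l))%N by rewrite !leq_max leqnn !orbT.
have tj := leq_maxl (tag t) (tag u); have uj := leq_maxr (tag t) (tag u).
have nm := leq_trans h2 km.
split=> //; rewrite !opP // (ds_trans_trans _ tj jm) (ds_trans_trans _ uj jm).
rewrite -(ds_trans_trans _ h1 km) h3 (ds_trans_trans _ h2 km).
by rewrite -(ds_trans_trans _ h4 lm) h6 (ds_trans_trans _ h5 lm).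
Qed.

Definition dl_add : L -> L -> L := dl_op2 (fun n => +%R).
Definition dl_mul : L -> L -> L := dl_op2 (fun n x y => x ** y).
Definition dl_opp : L -> L := dl_op1 (fun n x => - x).
Definition dl_scale (a : A) : L -> L := dl_op1 (fun n x => a *: x).
Definition dl_zero : L := dl_in (0 : D 0).

Lemma dl_addE n (x y : D n) : dl_add (dl_in x) (dl_in y) = dl_in (x + y).
Proof. by apply: dl_op2E => *; rewrite ds_transD. Qed.
Lemma dl_mulE n (x y : D n) : dl_mul (dl_in x) (dl_in y) = dl_in (x ** y).
Proof. by apply: dl_op2E => *; rewrite ds_transM. Qed.
Lemma dl_oppE n (x : D n) : dl_opp (dl_in x) = dl_in (- x).
Proof. by apply: (dl_op1E (op := fun n x => - x)) => *; rewrite ds_transN. Qed.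
Lemma dl_scaleE n a (x : D n) : dl_scale a (dl_in x) = dl_in (a *: x).
Proof.
by apply: (dl_op1E (op := fun n x => a *: x)) => *; rewrite ds_transZ.
Qed.
Lemma dl_zeroE n : dl_zero = dl_in (0 : D n).
Proof. by rewrite /dl_zero -(dl_in_trans _ (leq0n n)) ds_trans0. Qed.

Fact dl_addA : associative dl_add.
Proof.
by move=> x y z; have [n [a [b [c [-> -> ->]]]]] := dl_inP3 x y z;
   rewrite !dl_addE addrA.
Qed.
Fact dl_addC : commutative dl_add.
Proof.
by move=> x y; have [n [a [b [-> ->]]]] := dl_inP2 x y; rewrite !dl_addE addrC.
Qed.
Fact dl_add0 : left_id dl_zero dl_add.
Proof.
by move=> x; have [n [a ->]] := dl_inP x; rewrite (dl_zeroE n) dl_addE add0r.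
Qed.
Fact dl_addN : left_inverse dl_zero dl_opp dl_add.
Proof.
by move=> x; have [n [a ->]] := dl_inP x;
   rewrite (dl_zeroE n) dl_oppE dl_addE addNr.
Qed.

HB.instance Definition _ :=
  GRing.isZmodule.Build L dl_addA dl_addC dl_add0 dl_addN.

Fact dl_scaleA a b x : dl_scale a (dl_scale b x) = dl_scale (a * b) x.
Proof. by have [n [u ->]] := dl_inP x; rewrite !dl_scaleE scalerA. Qed.
Fact dl_scale1 : left_id 1 dl_scale.
Proof. by move=> x; have [n [u ->]] := dl_inP x; rewrite dl_scaleE scale1r. Qed.
Fact dl_scaleDr : right_distributive dl_scale +%R.
Proof.
move=> a x y; have [n [u [v [-> ->]]]] := dl_inP2 x y.
by rewrite [_ + _]dl_addE !dl_scaleE scalerDr [RHS]dl_addE.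
Qed.
Fact dl_scaleDl x : {morph dl_scale^~ x : a b / a + b}.
Proof.
move=> a b; have [n [u ->]] := dl_inP x.
by rewrite !dl_scaleE scalerDl [RHS]dl_addE.
Qed.

HB.instance Definition _ := GRing.Zmodule_isLmodule.Build A L
  dl_scaleA dl_scale1 dl_scaleDr dl_scaleDl.

Lemma dl_inD n : {morph @dl_in n : x y / x + y}.
Proof. by move=> x y; rewrite [RHS]dl_addE. Qed.
Lemma dl_in0 n : dl_in (0 : D n) = 0.
Proof. by rewrite -dl_zeroE. Qed.
Lemma dl_inN n (x : D n) : dl_in (- x) = - dl_in x.
Proof. by rewrite [RHS]dl_oppE. Qed.
Lemma dl_inZ n a (x : D n) : dl_in (a *: x) = a *: dl_in x.
Proof. by rewrite [RHS]dl_scaleE. Qed.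

Definition dl_homog (g : G) (x : L) : Prop :=
  exists n, exists2 a : D n, ghomog (D n) g a & x = dl_in a.

Lemma dl_homog0 g : dl_homog g 0.
Proof. by exists 0%N, 0; [exact: homog0|]. Qed.

Lemma dl_homogP2 g h x y : dl_homog g x -> dl_homog h y ->
  exists n, exists a : D n, exists b : D n,
  [/\ ghomog _ g a, ghomog _ h b, x = dl_in a & y = dl_in b].
Proof.
move=> [n [a ga ->]] [m [b hb ->]].
exists (maxn n m), (ds_trans _ a), (ds_trans _ b).
by rewrite !dl_in_trans ?leq_maxl ?leq_maxr //; split=> //;
  apply: ds_transh; rewrite ?leq_maxl ?leq_maxr.
Qed.

Lemma dl_homogB g x y : dl_homog g x -> dl_homog g y -> dl_homog g (x - y).
Proof.
move=> hx hy; have [n [a [b [ga gb -> ->]]]] := dl_homogP2 hx hy.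
by exists n, (a - b); [exact: homogB|rewrite dl_inD dl_inN].
Qed.

Lemma dl_homog_span x : spanned dl_homog x.
Proof.
have [n [a ->]] := dl_inP x.
apply: (@spanned_map _ _ _ (ghomog (D n)) _ (@dl_in n)).
- exact: dl_in0.
- exact: dl_inD.
by move=> g u gu; exists g, n, u.
Qed.

Lemma dl_common (s : seq G) (c : G -> L) : (forall g, dl_homog g (c g)) ->
  exists n, exists a : G -> D n, (forall g, ghomog _ g (a g)) /\
    (forall g, g \in s -> c g = dl_in (a g)).
Proof.
move=> hc; elim: s => [|g s [n [a [ha ca]]]].
  by exists 0%N, (fun=> 0); split=> // g; exact: homog0.
have [m [b hb cb]] := hc g.
have le1 := leq_maxl n m; have le2 := leq_maxr n m.
exists (maxn n m), (fun h => if h == g then ds_trans _ b else ds_trans _ (a h)).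
split=> h.
  by case: eqP => [->|_]; apply: ds_transh.
rewrite inE; case: eqP => [->|_] /=; first by rewrite dl_in_trans.
by move=> hs; rewrite dl_in_trans // ca.
Qed.

Lemma dl_homog_direct (s : seq G) (c : G -> L) :
  uniq s -> (forall g, dl_homog g (c g)) -> \sum_(g <- s) c g = 0 ->
  forall g, g \in s -> c g = 0.
Proof.
move=> us hc sc0 g gs; have [n [a [ha ca]]] := dl_common s hc.
have : dl_in (\sum_(h <- s) a h) = dl_in (0 : D n).
  rewrite dl_in0 -sc0 (big_morph _ (@dl_inD n) (dl_in0 n)) !big_seq.
  by apply: eq_bigr => h /ca ->.
move=> /dl_in_eq[k [nk _]]; rewrite ds_trans0 //.
rewrite (big_morph _ (ds_transD nk) (ds_trans0 nk)) => sa0.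
rewrite ca // -(dl_in_trans _ nk) -[RHS](dl_in0 k); congr dl_in.
apply: (@homog_direct _ _ (ghomog (D k)) s (fun h => ds_trans k (a h))) => //.
by move=> h; exact: ds_transh.
Qed.

Definition dl_grading : grading G L :=
  Grading dl_homog0 dl_homogB dl_homog_span dl_homog_direct.

Fact dl_mulA : associative dl_mul.
Proof.
by move=> x y z; have [n [a [b [c [-> -> ->]]]]] := dl_inP3 x y z;
   rewrite !dl_mulE gmulA.
Qed.
Fact dl_mulDl : left_distributive dl_mul +%R.
Proof.
by move=> x y z; have [n [a [b [c [-> -> ->]]]]] := dl_inP3 x y z;
   rewrite -dl_inD !dl_mulE -dl_inD gmulDl.
Qed.
Fact dl_mulDr : right_distributive dl_mul +%R.
Proof.
by move=> x y z; have [n [a [b [c [-> -> ->]]]]] := dl_inP3 x y z;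
   rewrite -dl_inD !dl_mulE -dl_inD gmulDr.
Qed.
Fact dl_scaleAl a x y : a *: dl_mul x y = dl_mul (a *: x) y.
Proof.
by have [n [u [v [-> ->]]]] := dl_inP2 x y;
   rewrite -dl_inZ !dl_mulE -dl_inZ gscaleAl.
Qed.
Fact dl_scaleAr a x y : a *: dl_mul x y = dl_mul x (a *: y).
Proof.
by have [n [u [v [-> ->]]]] := dl_inP2 x y;
   rewrite -dl_inZ !dl_mulE -dl_inZ gscaleAr.
Qed.
Fact dl_homogM g h x y :
  dl_grading g x -> dl_grading h y -> dl_grading (g + h) (dl_mul x y).
Proof.
move=> hx hy; have [n [a [b [ga gb -> ->]]]] := dl_homogP2 hx hy.
by exists n, (a ** b); [exact: ghomogM|rewrite dl_mulE].
Qed.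
Fact dl_homogZ g h a x :
  gA g a -> dl_grading h x -> dl_grading (g + h) (a *: x).
Proof.
move=> ga [n [u hu ->]].
by exists n, (a *: u); [exact: ghomogZ|rewrite dl_inZ].
Qed.

Definition dirlim : galg gA :=
  @GAlg G A gA L dl_mul dl_mulA dl_mulDl dl_mulDr
    dl_scaleAl dl_scaleAr dl_grading dl_homogM dl_homogZ.

End DirectLimit.

Record star_dirseq (G : zmodType) (A : comPzRingType) (gA : ring_grading G A)
    (sA : ring_involution gA) := StarDirSeq {
  sds_obj :> nat -> gsalg sA;
  sds_map : forall n, sds_obj n -> sds_obj n.+1;
  sds_hom : forall n, graded_star_alg_hom (@sds_map n)
}.

Section StarDirectLimit.
Variables (G : zmodType) (A : comPzRingType) (gA : ring_grading G A).
Variables (sA : ring_involution gA) (D : star_dirseq sA).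

Definition sds_dirseq : dirseq gA :=
  @DirSeq G A gA (fun n => gsalg_galg (D n)) (@sds_map _ _ _ _ D)
    (fun n => proj1 (sds_hom D n)).

Local Notation L := (dirlim sds_dirseq).

Definition dl_star : L -> L :=
  @dl_op1 _ _ _ sds_dirseq (fun n (x : D n) => gstar x).

Lemma ds_trans_star n m (x : D n) : (n <= m)%N ->
  @ds_trans _ _ _ sds_dirseq n m (gstar x) =
  gstar (@ds_trans _ _ _ sds_dirseq n m x : D m).
Proof.
elim: m => [|p IH].
  by rewrite leqn0 => /eqP n0; subst n; rewrite !ds_trans_id.
rewrite leq_eqVlt => /predU1P[e|]; first by subst n; rewrite !ds_trans_id.
rewrite ltnS => np; rewrite !ds_transS // IH //.
by have [_ h] := sds_hom D p; rewrite -h.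
Qed.

Lemma dl_starE n (x : D n) :
  dl_star (@dl_in _ _ _ sds_dirseq n x) =
  @dl_in _ _ _ sds_dirseq n (gstar x).
Proof.
apply: (@dl_op1E _ _ _ sds_dirseq (fun n (x : D n) => gstar x)) => i j y le.
exact: ds_trans_star.
Qed.

Fact dl_starK : involutive dl_star.
Proof.
by move=> x; have [n [a ->]] := dl_inP x; rewrite !dl_starE gstarK.
Qed.
Fact dl_starD : {morph dl_star : x y / x + y}.
Proof.
move=> x y; have [n [a [b [-> ->]]]] := dl_inP2 x y.
by rewrite -[in LHS]dl_inD !dl_starE gstarD dl_inD.
Qed.
Fact dl_starM (x y : L) : dl_star (x ** y) = dl_star y ** dl_star x.
Proof.
have [n [a [b [-> ->]]]] := dl_inP2 x y.
by rewrite [_ ** _]dl_mulE !dl_starE gstarM [RHS]dl_mulE.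
Qed.
Fact dl_starZ a (x : L) : dl_star (a *: x) = sA a *: dl_star x.
Proof.
have [n [u ->]] := dl_inP x.
by rewrite -[in LHS]dl_inZ !dl_starE gstarZ dl_inZ.
Qed.
Fact dl_star_homog g (x : L) : ghomog _ g x -> ghomog _ (- g) (dl_star x).
Proof.
move=> [n [a ga ->]]; exists n, (gstar (a : D n)); last by rewrite dl_starE.
exact: gstar_homog.
Qed.

Definition star_dirlim : gsalg sA :=
  GSAlg dl_starK dl_starD dl_starM dl_starZ dl_star_homog.

End StarDirectLimit.

Definition ultramatricial (G : zmodType) (A : comPzRingType)
    (gA : ring_grading G A) (R : galg gA) : Prop :=
  exists (s : nat -> mshape G)
    (f : forall n, matricial gA (s n) -> matricial gA (s n.+1))
    (hf : forall n, graded_alg_hom (f n)),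
  graded_alg_isomorphic R
    (dirlim (@DirSeq G A gA (fun n => matricial gA (s n)) f hf)).

Definition ultramatricial_star (G : zmodType) (A : comPzRingType)
    (gA : ring_grading G A) (sA : ring_involution gA) (R : gsalg sA) : Prop :=
  exists (s : nat -> mshape G)
    (f : forall n, matricial_star sA (s n) -> matricial_star sA (s n.+1))
    (hf : forall n, graded_star_alg_hom (f n)),
  graded_star_alg_isomorphic R
    (star_dirlim (@StarDirSeq G A gA sA (fun n => matricial_star sA (s n)) f hf)).

(* Main.v *)
(* Instead of K-theory the proof runs an Elliott intertwining directly on the
   degree-0 idempotents. In a graded matricial algebra M over a graded field, the
   corner e_i M_d e_j cut out by two diagonal matrix units is zero or consists of
   0 and invertible elements. Gaussian elimination on these corners shows that
   every degree-0 idempotent is conjugate to a sum of diagonal units and that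
   cancellation holds; in the *-case, with a projection and a unitary, Gaussian
   elimination is replaced by a reflection, and this is where 2-properness, the
   *-pythagorean property and the unitaries are used.
   A graded ring isomorphism f : R -> S sends the matrix units of a stage of R to
   matrix units of S, and the A-linear extension g of this assignment (after
   replacing the images by equivalent *-matrix units in the *-case) agrees with f
   on degree-0 idempotents up to equivalence. In the same way f^-1 gives maps h in
   the other direction; h g agrees with the connecting map of R up to equivalence
   on the diagonal units, hence up to conjugation, so that h can be corrected by a
   unit to make the triangles commute exactly. *)

Require Import Defs.
From mathcomp Require Import all_boot all_order all_algebra all_fingroup.
From mathcomp Require Import boolp.

Set Implicit Arguments.
Unset Strict Implicit.
Unset Printing Implicit Defensive.

Import GRing.Theory.
Local Open Scope ring_scope.

Local Notation "x ** y" := (gmul x y) (at level 40, left associativity).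

#[local] Arguments matricial : simpl never.

(** * Graded groups and rings *)

Section Grading.
Variables (G V : zmodType) (h : grading G V).

Lemma homogN g x : h g x -> h g (- x).
Proof. by move=> hx; rewrite -sub0r; apply: homogB => //; exact: homog0. Qed.

Lemma homogD g x y : h g x -> h g y -> h g (x + y).
Proof. by move=> hx hy; rewrite -[y]opprK; apply: homogB => //;
  exact: homogN. Qed.

Lemma homog_sum g (I : Type) (r : seq I) (P : pred I) (F : I -> V) :
  (forall i, P i -> h g (F i)) -> h g (\sum_(i <- r | P i) F i).
Proof. by move=> hF; apply: big_ind => //; [exact: homog0 | exact: homogD]. Qed.

(** [homog_span] may repeat degrees; collecting equal ones makes [homog_direct] applicable. The
    degree k is listed even if its component is 0, so that this component can be named
    afterwards. *)
Lemma homog_decomposition (k : G) x : exists (s : seq G) (c : G -> V),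
  [/\ uniq s, k \in s, forall g, h g (c g) & x = \sum_(g <- s) c g].
Proof.
have [r [hr ->]] := homog_span h x.
suff [s [c [us ks hc _ ->]]] : exists (s : seq G) (c : G -> V),
    [/\ uniq s, k \in s, forall g, h g (c g), forall g, g \notin s -> c g = 0
      & \sum_(y <- r) y = \sum_(g <- s) c g] by exists s, c.
elim: r hr => [|y r IH] hr.
  exists [:: k], (fun=> 0); rewrite !inE eqxx big_nil big_seq1; split=> // g.
  exact: homog0.
have [|s [c [us ks hc sc e]]] := IH; first by move=> z zr; apply: hr;
  rewrite inE zr orbT.
have [g hg] := hr y (mem_head _ _).
exists (undup (g :: s)), (fun j => c j + (if j == g then y else 0)).
have gs : g \in undup (g :: s) by rewrite mem_undup mem_head.
split.
- exact: undup_uniq.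
- by rewrite mem_undup inE ks orbT.
- by move=> j; apply: homogD => //; case: eqP => [->|_] //; exact: homog0.
- move=> j; rewrite mem_undup inE negb_or => /andP[/negPf -> /sc ->].
  by rewrite addr0.
rewrite big_split big_cons e addrC; congr (_ + _).
  rewrite /=; case: ifP => gns; first by rewrite undup_id.
  by rewrite big_cons sc ?gns // add0r undup_id.
by rewrite (bigD1_seq g) ?undup_uniq //= eqxx big1 ?addr0 // => j /negPf ->.
Qed.

Lemma homog_component (s : seq G) (c : G -> V) (k : G) :
  uniq s -> (forall g, h g (c g)) -> k \in s -> h k (\sum_(g <- s) c g) ->
  c k = \sum_(g <- s) c g.
Proof.
move=> us hc ks; set x := \sum_(g <- s) c g => hx.
apply/eqP; rewrite -subr_eq0; apply/eqP.
have := @homog_direct _ _ h s (fun g => c g - (if g == k then x else 0)) us.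
move=> /(_ _ _ k ks); rewrite eqxx; apply.
  by move=> g; apply: homogB => //; case: eqP => [->|_] //; exact: homog0.
rewrite sumrB -/x [X in _ - X](bigD1_seq k) //= eqxx big1 ?addr0 ?subrr //.
by move=> j /negPf ->.
Qed.

End Grading.

(** When f x has degree g it equals its own component f (c g), so x = c g by injectivity. This makes
    inverses of graded isomorphisms graded. *)
Lemma homog_of_image (G V W : zmodType) (hV : grading G V) (hW : grading G W)
    (f : V -> W) : {morph f : x y / x + y} -> injective f ->
  (forall g x, hV g x -> hW g (f x)) -> forall g x, hW g (f x) -> hV g x.
Proof.
move=> fD fI fh g x hx; have [s [c [us gs hc ex]]] :=
  homog_decomposition hV g x.
have f0 : f 0 = 0 by apply: (addrI (f 0)); rewrite -fD !addr0.
suff /fI <- : f (c g) = f x by [].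
have fx : f x = \sum_(k <- s) f (c k) by rewrite ex (big_morph f fD f0).
rewrite fx; apply: (@homog_component _ _ hW s (fun k => f (c k))) => //.
- by move=> k; exact: fh.
- by rewrite -fx.
Qed.

Section GradedRing.
Variables (G : zmodType) (A : comPzRingType) (gA : ring_grading G A).

Lemma homogM_component (g k : G) (s : seq G) (c : G -> A) (a : A) :
  uniq s -> k \in s -> (forall j, gA j (c j)) -> gA g a ->
  gA (g + k) (a * \sum_(j <- s) c j) -> a * c k = a * \sum_(j <- s) c j.
Proof.
move=> us ks hc ha hab.
have E : a * \sum_(j <- s) c j = \sum_(j <- [seq g + i | i <- s]) a * c (j - g).
  rewrite big_map mulr_sumr; apply: eq_bigr => j _.
  by rewrite [g + j]addrC addrK.
rewrite E in hab *.
rewrite -(homog_component _ _ _ hab).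
- by rewrite [g + k]addrC addrK.
- by rewrite map_inj_uniq //; exact: addrI.
- by move=> j; have := rg_homogM ha (hc (j - g)); rewrite addrCA subrr addr0.
- exact: map_f.
Qed.

(** Comparing degrees in a = a 1 gives a (c 0) = a for homogeneous a; summing over the components of
    1 gives c 0 = 1. *)
Lemma homog1 : gA 0 1.
Proof.
have [s [c [us ks hc e1]]] := homog_decomposition gA 0 1.
have H a g : gA g a -> a * c 0 = a.
  move=> ha; rewrite (homogM_component us ks hc ha) -e1 mulr1 //.
  by rewrite addr0.
suff <- : c 0 = 1 by [].
rewrite -[LHS]mul1r [in LHS]e1 mulr_suml e1; apply: eq_bigr => g _.
exact: H (hc g).
Qed.

Hypothesis fA : graded_field gA.

(** [graded_field] promises some inverse b; as a b = 1 has degree 0, the component of b of degree -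
    g is already an inverse. *)
Lemma homog_inverse g a : gA g a -> a <> 0 -> exists2 b, gA (- g) b & a * b = 1.
Proof.
move=> ha a0; have [b ab] := fA ha a0.
have [s [c [us ks hc eb]]] := homog_decomposition gA (- g) b.
exists (c (- g)) => //; rewrite (homogM_component us ks hc ha) -eb ab //.
by rewrite subrr; exact: homog1.
Qed.

End GradedRing.

(** * Arithmetic and homomorphisms of graded algebras *)

Section GradedHoms.
Variables (G : zmodType) (A : comPzRingType) (gA : ring_grading G A).
Implicit Types R S T : galg gA.

Lemma gmul0r R (x : R) : 0 ** x = 0.
Proof. by apply: (addrI (0 ** x)); rewrite -gmulDl !addr0. Qed.
Lemma gmulr0 R (x : R) : x ** 0 = 0.
Proof. by apply: (addrI (x ** 0)); rewrite -gmulDr !addr0. Qed.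
Lemma gmulNr R (x y : R) : (- x) ** y = - (x ** y).
Proof. by apply/eqP; rewrite -addr_eq0 -gmulDl addNr gmul0r. Qed.
Lemma gmulrN R (x y : R) : x ** (- y) = - (x ** y).
Proof. by apply/eqP; rewrite -addr_eq0 -gmulDr addNr gmulr0. Qed.
Lemma gmulBl R (x y z : R) : (x - y) ** z = x ** z - y ** z.
Proof. by rewrite gmulDl gmulNr. Qed.
Lemma gmulBr R (x y z : R) : z ** (x - y) = z ** x - z ** y.
Proof. by rewrite gmulDr gmulrN. Qed.
Lemma gmul_suml R (I : Type) (r : seq I) (P : pred I) (F : I -> R) x :
  (\sum_(i <- r | P i) F i) ** x = \sum_(i <- r | P i) F i ** x.
Proof.
by apply: (big_morph (fun y => y ** x)) => [y z|]; rewrite ?gmulDl ?gmul0r.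
Qed.
Lemma gmul_sumr R (I : Type) (r : seq I) (P : pred I) (F : I -> R) x :
  x ** (\sum_(i <- r | P i) F i) = \sum_(i <- r | P i) x ** F i.
Proof. by apply: (big_morph _ (gmulDr x) (gmulr0 x)). Qed.

Lemma hom_homog R S (f : R -> S) g x :
  graded_ring_hom f -> ghomog R g x -> ghomog S g (f x).
Proof. by case=> _ _; exact. Qed.
Lemma homM R S (f : R -> S) : graded_ring_hom f -> {morph f : x y / x ** y}.
Proof. by case. Qed.
Lemma homD R S (f : R -> S) : graded_ring_hom f -> {morph f : x y / x + y}.
Proof. by case. Qed.
Lemma hom0 R S (f : R -> S) : graded_ring_hom f -> f 0 = 0.
Proof. by case=> fD _ _; apply: (addrI (f 0)); rewrite -fD !addr0. Qed.
Lemma hom_sum R S (f : R -> S) (I : Type) (r : seq I) (P : pred I) (F : I -> R)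
  :
  graded_ring_hom f ->
  f (\sum_(i <- r | P i) F i) = \sum_(i <- r | P i) f (F i).
Proof. by move=> fh; exact: (big_morph f (homD fh) (hom0 fh)). Qed.

Lemma graded_ring_hom_comp R S T (f : R -> S) (g : S -> T) :
  graded_ring_hom f -> graded_ring_hom g -> graded_ring_hom (g \o f).
Proof.
move=> [fD fM fh] [gD gM gh]; split=> [x y|x y|k x hx] /=.
- by rewrite fD gD.
- by rewrite fM gM.
- exact/gh/fh.
Qed.

Lemma graded_alg_hom_comp R S T (f : R -> S) (g : S -> T) :
  graded_alg_hom f -> graded_alg_hom g -> graded_alg_hom (g \o f).
Proof.
move=> [fh fZ] [gh gZ]; split; first exact: graded_ring_hom_comp.
by move=> a x /=; rewrite fZ gZ.
Qed.

Lemma graded_ring_hom_inv R S (f : R -> S) (f' : S -> R) :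
  cancel f f' -> cancel f' f -> graded_ring_hom f -> graded_ring_hom f'.
Proof.
move=> fK f'K fh; have fI := can_inj fK; split=> [x y|x y|g x hx].
- by apply: fI; rewrite (homD fh) !f'K.
- by apply: fI; rewrite (homM fh) !f'K.
by case: (fh) => fD _ fg; apply: (homog_of_image fD fI fg); rewrite f'K.
Qed.

Lemma graded_alg_hom_inv R S (f : R -> S) (f' : S -> R) :
  cancel f f' -> cancel f' f -> graded_alg_hom f -> graded_alg_hom f'.
Proof.
move=> fK f'K [fh fZ]; split; first exact: graded_ring_hom_inv fh.
by move=> a x; apply: (can_inj fK); rewrite fZ !f'K.
Qed.

End GradedHoms.

(** * Equivalence of idempotents *)

Section Equivalence.
Variables (G : zmodType) (A : comPzRingType) (gA : ring_grading G A).
Variable T : galg gA.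
Implicit Types (ad : T -> T -> Prop) (p q f x y u : T).

(** Modelled on the graph of an involution, hence the reversed product in [adM]. For such a graph
    [ad p p] says that p is self-adjoint, and [idem] that p is a projection of degree 0. *)
Record admissible ad : Prop := Admissible {
  ad0 : ad 0 0;
  adD : forall x x' y y', ad x x' -> ad y y' -> ad (x + y) (x' + y');
  adN : forall x x', ad x x' -> ad (- x) (- x');
  adM : forall x x' y y', ad x x' -> ad y y' -> ad (x ** y) (y' ** x');
  adC : forall x x', ad x x' -> ad x' x
}.

Definition anyrel x y : Prop := True.

Lemma admissible_any : admissible anyrel.
Proof. by []. Qed.

Record idem ad p : Prop := Idem {
  idem_ad : ad p p;
  idem_homog : ghomog T 0 p;
  idemK : p ** p = p
}.

Definition below p f : Prop := f ** p = p /\ p ** f = p.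
Definition orth p q : Prop := p ** q = 0 /\ q ** p = 0.

(** Murray-von Neumann equivalence, with a degree. In the *-case y = x*, so x is a partial isometry.
    The equations x q = x and y p = y follow: see [ep_lq] and [ep_rp]. *)
Record eqv_pair ad (d : G) p q x y : Prop := EqvPair {
  ep_ad : ad x y;
  ep_homl : ghomog T d x;
  ep_homr : ghomog T (- d) y;
  ep_xy : x ** y = p;
  ep_yx : y ** x = q;
  ep_pl : p ** x = x;
  ep_pr : q ** y = y
}.

Definition eqv ad d p q : Prop := exists x y, eqv_pair ad d p q x y.

Lemma ep_lq ad d p q x y : eqv_pair ad d p q x y -> x ** q = x.
Proof. by case=> _ _ _ <- <- + _; rewrite gmulA. Qed.

Lemma ep_rp ad d p q x y : eqv_pair ad d p q x y -> y ** p = y.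
Proof. by case=> _ _ _ <- <- _; rewrite gmulA. Qed.

Lemma eqv_any ad d p q : eqv ad d p q -> eqv anyrel d p q.
Proof. by move=> [x [y [_ *]]]; exists x, y. Qed.

Lemma idem_any ad p : idem ad p -> idem anyrel p.
Proof. by case. Qed.

Section Admissible.
Variables (ad : T -> T -> Prop) (adA : admissible ad).

Lemma eqv_pair_sym d p q x y :
  eqv_pair ad d p q x y -> eqv_pair ad (- d) q p y x.
Proof. by case=> *; split=> //; [exact: adC | rewrite opprK]. Qed.

Lemma eqv_sym d p q : eqv ad d p q -> eqv ad (- d) q p.
Proof. by move=> [x [y /eqv_pair_sym ?]]; exists y, x. Qed.

Lemma eqv_sym0 p q : eqv ad 0 p q -> eqv ad 0 q p.
Proof. by move/eqv_sym; rewrite oppr0. Qed.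

Lemma eqv_pair_trans d e p q r x y z w : eqv_pair ad d p q x y ->
  eqv_pair ad e q r z w -> eqv_pair ad (d + e) p r (x ** z) (w ** y).
Proof.
move=> H K; case: (H) (K) => a1 h1 h1' xy yx px qy [a2 h2 h2' zw wz qz rw].
split.
- exact: adM.
- exact: ghomogM.
- by rewrite opprD addrC; exact: ghomogM.
- by rewrite gmulA -(gmulA x) zw (ep_lq H).
- by rewrite gmulA -(gmulA w) yx (ep_rp K).
- by rewrite gmulA px.
- by rewrite gmulA rw.
Qed.

Lemma eqv_trans d e p q r : eqv ad d p q -> eqv ad e q r -> eqv ad (d + e) p r.
Proof.
by move=> [x [y H]] [z [w K]]; exists (x ** z), (w ** y);
   exact: eqv_pair_trans K.
Qed.

Lemma eqv_trans0 p q r : eqv ad 0 p q -> eqv ad 0 q r -> eqv ad 0 p r.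
Proof. by move=> H K; have := eqv_trans H K; rewrite addr0. Qed.

Lemma eqv_pair_refl p : idem ad p -> eqv_pair ad 0 p p p p.
Proof. by case=> *; split; rewrite ?oppr0. Qed.

Lemma eqv_refl p : idem ad p -> eqv ad 0 p p.
Proof. by exists p, p; exact: eqv_pair_refl. Qed.

Lemma eqv_idem d p q : eqv ad d p q -> idem ad p.
Proof.
move=> [x [y [a h h' xy yx px qy]]]; split.
- by rewrite -xy; apply: adM => //; exact: adC.
- by rewrite -xy -(subrr d); exact: ghomogM.
- by rewrite -[in RHS]xy -[in RHS]px -gmulA xy.
Qed.

Lemma eqv_idemr d p q : eqv ad d p q -> idem ad q.
Proof. by move/eqv_sym/eqv_idem. Qed.

Lemma eqv00 d : eqv ad d 0 0.
Proof.
by exists 0, 0; split; rewrite ?gmul0r //; [exact: ad0 | exact: homog0..].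
Qed.

Lemma eqv_pair_add d p q x y p' q' x' y' :
  orth p p' -> orth q q' ->
  eqv_pair ad d p q x y -> eqv_pair ad d p' q' x' y' ->
  eqv_pair ad d (p + p') (q + q') (x + x') (y + y').
Proof.
move=> [pp' p'p] [qq' q'q] H H'.
case: (H) (H') => a1 h1 h1' xy yx px qy [a2 h2 h2' xy' yx' px' qy'].
have px'0 : p ** x' = 0 by rewrite -px' gmulA pp' gmul0r.
have p'x0 : p' ** x = 0 by rewrite -px gmulA p'p gmul0r.
have qy'0 : q ** y' = 0 by rewrite -qy' gmulA qq' gmul0r.
have q'y0 : q' ** y = 0 by rewrite -qy gmulA q'q gmul0r.
split.
- exact: adD.
- exact: homogD.
- exact: homogD.
- rewrite gmulDl !gmulDr xy xy' -(ep_lq H) -(ep_lq H') -!gmulA qy'0 q'y0.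
  by rewrite !gmulr0 addr0 add0r.
- rewrite gmulDl !gmulDr yx yx' -(ep_rp H) -(ep_rp H') -!gmulA px'0 p'x0.
  by rewrite !gmulr0 addr0 add0r.
- by rewrite gmulDl !gmulDr px px' px'0 p'x0 addr0 add0r.
- by rewrite gmulDl !gmulDr qy qy' qy'0 q'y0 addr0 add0r.
Qed.

Lemma eqv_add d p q p' q' : orth p p' -> orth q q' ->
  eqv ad d p q -> eqv ad d p' q' -> eqv ad d (p + p') (q + q').
Proof.
move=> o o' [x [y H]] [x' [y' H']].
by exists (x + x'), (y + y'); exact: eqv_pair_add.
Qed.

Lemma eqv_pair_sum (I : eqType) (r : seq I) d (P Q X Y : I -> T) : uniq r ->
  {in r &, forall i j, i != j -> orth (P i) (P j)} ->
  {in r &, forall i j, i != j -> orth (Q i) (Q j)} ->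
  {in r, forall i, eqv_pair ad d (P i) (Q i) (X i) (Y i)} ->
  eqv_pair ad d (\sum_(i <- r) P i) (\sum_(i <- r) Q i)
    (\sum_(i <- r) X i) (\sum_(i <- r) Y i).
Proof.
elim: r => [|i r IH] /=.
  by rewrite !big_nil => *; split; rewrite ?gmul0r //;
    [exact: ad0|exact: homog0..].
move=> /andP[ir ur] oP oQ PQ; rewrite !big_cons.
have sr : {subset r <= i :: r} by move=> j jr; rewrite inE jr orbT.
have ne j : j \in r -> i != j by apply: contraTneq => <-.
have orth_sum (F : I -> T) :
    {in i :: r &, forall i j, i != j -> orth (F i) (F j)} ->
  orth (F i) (\sum_(j <- r) F j).
  move=> oF; split; rewrite ?gmul_suml ?gmul_sumr big_seq big1 // => j jr.
    by have [] := oF i j (mem_head _ _) (sr _ jr) (ne _ jr).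
  by have [] := oF i j (mem_head _ _) (sr _ jr) (ne _ jr).
apply: eqv_pair_add; [exact: orth_sum|exact: orth_sum| |].
- exact/PQ/mem_head.
- apply: IH => // [j k jr kr|j k jr kr|j jr].
  + exact: oP (sr _ jr) (sr _ kr).
  + exact: oQ (sr _ jr) (sr _ kr).
  + exact/PQ/sr.
Qed.

Lemma eqv_sum (I : eqType) (r : seq I) d (P Q : I -> T) : uniq r ->
  {in r &, forall i j, i != j -> orth (P i) (P j)} ->
  {in r &, forall i j, i != j -> orth (Q i) (Q j)} ->
  {in r, forall i, eqv ad d (P i) (Q i)} ->
  eqv ad d (\sum_(i <- r) P i) (\sum_(i <- r) Q i).
Proof.
move=> ur oP oQ PQ.
have [XY XYP] : {XY : I -> T * T &
    forall i, i \in r -> eqv_pair ad d (P i) (Q i) (XY i).1 (XY i).2}.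
  apply: (@choice _ _ (fun i xy => i \in r -> eqv_pair ad d (P i) (Q i)
    xy.1 xy.2)).
  move=> i; have [/PQ[x [y H]]|_] := boolP (i \in r); first by exists (x, y).
  by exists (0, 0).
by eexists; eexists; exact: eqv_pair_sum ur oP oQ XYP.
Qed.

Lemma idem_sum (I : eqType) (r : seq I) (P : I -> T) : uniq r ->
  {in r &, forall i j, i != j -> orth (P i) (P j)} ->
  {in r, forall i, idem ad (P i)} -> idem ad (\sum_(i <- r) P i).
Proof.
move=> ur oP iP; apply: (@eqv_idem 0 _ (\sum_(i <- r) P i)).
by apply: eqv_sum => // i ir; apply: eqv_refl; exact: iP.
Qed.

(** Conjugation by u identifies the corner of f with that of f', and p u witnesses that an
    idempotent p stays in its class. *)
Lemma eqv_pair_restrict d f f' u u' p : eqv_pair ad d f f' u u' ->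
  idem ad p -> below p f ->
  eqv_pair ad d p (u' ** p ** u) (p ** u) (u' ** p).
Proof.
move=> H [ap hp pp] [fp pf]; case: (H) => a h h' uu' u'u fu f'u'.
split.
- exact: adM.
- by rewrite -[d]add0r; exact: ghomogM.
- by rewrite -[- d]addr0; exact: ghomogM.
- by rewrite gmulA -(gmulA p) uu' pf pp.
- by rewrite gmulA -(gmulA u') pp.
- by rewrite gmulA pp.
- by rewrite -!gmulA (gmulA u) uu' fp pp.
Qed.

Lemma idemB p f : idem ad p -> idem ad f -> below p f -> idem ad (f - p).
Proof.
move=> [a h pp] [a' h' ff] [fp pf]; split.
- by apply: adD => //; exact: adN.
- exact: homogB.
- by rewrite gmulBl !gmulBr ff fp pf pp subrr subr0.
Qed.

End Admissible.

Lemma belowB p f : idem anyrel f -> below p f -> below (f - p) f.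
Proof. by move=> [_ _ ff] [fp pf]; split; rewrite ?gmulBr ?gmulBl ff ?fp ?pf.
  Qed.

Lemma orthB p f : idem anyrel p -> below p f -> orth p (f - p).
Proof.
by move=> [_ _ pp] [fp pf]; split; rewrite ?gmulBr ?gmulBl pp ?fp ?pf subrr.
Qed.

Lemma belowDr p q : idem anyrel q -> orth p q -> below q (p + q).
Proof. by move=> [_ _ qq] [pq qp]; split; rewrite ?gmulDl ?gmulDr ?qq ?pq ?qp
  add0r. Qed.

Lemma below_trans p q r : below p q -> below q r -> below p r.
Proof.
move=> [qp pq] [rq qr]; split; first by rewrite -qp gmulA rq.
by rewrite -pq -gmulA qr.
Qed.

Lemma belowDl p q : idem anyrel p -> orth p q -> below p (p + q).
Proof. by move=> [_ _ pp] [pq qp]; split; rewrite ?gmulDl ?gmulDr ?pp ?pq ?qp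
  addr0. Qed.

End Equivalence.
Arguments anyrel {G A gA T}.

Lemma eqv_map (G : zmodType) (A : comPzRingType) (gA : ring_grading G A)
    (T U : galg gA) (ad : T -> T -> Prop) (ad' : U -> U -> Prop) (g : T -> U)
      d p q :
  graded_ring_hom g -> (forall x y, ad x y -> ad' (g x) (g y)) ->
  eqv ad d p q -> eqv ad' d (g p) (g q).
Proof.
move=> [gD gM gh] gad [x [y [a h h' xy yx px qy]]]; exists (g x), (g y).
by split; rewrite -?gM ?xy ?yx ?px ?qy; auto.
Qed.

Lemma eqv_any_map (G : zmodType) (A : comPzRingType) (gA : ring_grading G A)
    (T U : galg gA) (g : T -> U) d p q :
  graded_ring_hom g -> eqv anyrel d p q -> eqv anyrel d (g p) (g q).
Proof. by move=> gh; apply: eqv_map. Qed.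

(** * Matrix units of a matricial algebra *)

Section MatrixUnits.
Variables (G : zmodType) (A : comPzRingType) (gA : ring_grading G A).

Local Notation M s := (matricial gA s).

Section Entries.
Variable s : mshape G.
Implicit Types (x y : M s) (b : 'I_(mblocks s)).

Definition entry x b (i j : 'I_(msize b)) : A :=
  ((x : dsum (fun b => mx_galg gA (@mshift G s b))) b : 'M[A]_(msize b)) i j.

Definition munit b (i j : 'I_(msize b)) : M s :=
  @dsum_in _ _ _ _ (fun b => mx_galg gA (@mshift G s b)) b (delta_mx i j).

Lemma entry_ext x y :
  (forall b (i j : 'I_(msize b)), entry x i j = entry y i j) -> x = y.
Proof. by move=> e; apply/ffunP => b; apply/matrixP => i j; exact: e. Qed.

Lemma entryD x y b (i j : 'I_(msize b)) :
  entry (x + y) i j = entry x i j + entry y i j.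
Proof. by rewrite /entry dsumDE mxE. Qed.
Lemma entryZ a x b (i j : 'I_(msize b)) : entry (a *: x) i j = a * entry x i j.
Proof. by rewrite /entry dsumZE mxE. Qed.
Lemma entry0 b (i j : 'I_(msize b)) : entry (0 : M s) i j = 0.
Proof. by rewrite /entry dsum0E mxE. Qed.
Lemma entry_sum (I : Type) (r : seq I) (P : pred I) (F : I -> M s)
    b (i j : 'I_(msize b)) :
  entry (\sum_(k <- r | P k) F k) i j = \sum_(k <- r | P k) entry (F k) i j.
Proof.
by apply: (big_morph (fun x => entry x i j)) => [x y|]; rewrite ?entryD ?entry0.
Qed.
Lemma entryM x y b (i j : 'I_(msize b)) :
  entry (x ** y) i j = \sum_k entry x i k * entry y k j.
Proof. by rewrite /entry /= /dsum_mul ffunE mxE. Qed.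

Lemma entry_munit b (i j k l : 'I_(msize b)) :
  entry (munit i j) k l = ((k == i) && (l == j))%:R.
Proof. by rewrite /entry dsum_in_eq mxE. Qed.

Lemma entry_munit_neq b b' (i j : 'I_(msize b)) (k l : 'I_(msize b')) :
  b <> b' -> entry (munit i j) k l = 0.
Proof. by move=> ne; rewrite /entry dsum_in_neq // mxE. Qed.

Lemma munitM_neq b b' (i j : 'I_(msize b)) x (k l : 'I_(msize b')) :
  b <> b' -> munit i j ** x ** munit k l = 0.
Proof.
move=> ne; apply: entry_ext => c i' j'; rewrite entryM entry0 big1 // => m _.
case: (b' =P c) => [e|ne']; last by rewrite [X in _ * X]entry_munit_neq ?mulr0.
rewrite [X in X * _]entryM big1 ?mul0r // => m' _.
by rewrite entry_munit_neq ?mul0r // => ebc; apply: ne; rewrite e.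
Qed.

Lemma munit_corner b (i j k l : 'I_(msize b)) x :
  munit i j ** x ** munit k l = entry x j k *: munit i l.
Proof.
apply: entry_ext => c i' j'; rewrite entryM entryZ.
case: (b =P c) => [e|ne]; last first.
  rewrite entry_munit_neq // mulr0 big1 // => m _.
  by rewrite [X in _ * X]entry_munit_neq ?mulr0.
subst c; rewrite (big_only1 k) // => [|m /negPf mk _]; last first.
  by rewrite [X in _ * X]entry_munit mk mulr0.
rewrite [X in _ * X]entry_munit eqxx entryM (big_only1 j) // =>
  [|m /negPf mj _].
  rewrite !entry_munit eqxx andbT.
  by case: (i' == i); rewrite ?mul1r ?mul0r ?mulr0.
by rewrite entry_munit mj andbF mul0r.
Qed.

Lemma matricial_expand x :
  x = \sum_b \sum_(i < msize b) \sum_(j < msize b) entry x i j *: munit i j.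
Proof.
apply: entry_ext => b i j; rewrite entry_sum (big_only1 b) // => [|c /eqP ne _].
  rewrite entry_sum (big_only1 i) // => [|k /negPf ne _].
    rewrite entry_sum (big_only1 j) // => [|l /negPf ne _].
      by rewrite entryZ entry_munit !eqxx mulr1.
    by rewrite entryZ entry_munit [j == l]eq_sym ne andbF mulr0.
  rewrite entry_sum big1 // => l _.
  by rewrite entryZ entry_munit eq_sym ne mulr0.
rewrite entry_sum big1 // => k _; rewrite entry_sum big1 // => l _.
by rewrite entryZ entry_munit_neq ?mulr0.
Qed.

Lemma munit_homog b (i j : 'I_(msize b)) :
  ghomog (M s) (mshift i - mshift j) (munit i j).
Proof.
move=> c k l; rewrite -/(entry (munit i j) k l).
case: (b =P c) => [e|ne]; last by rewrite entry_munit_neq //; exact: homog0.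
subst c; rewrite entry_munit; case: andP => [[/eqP -> /eqP ->]|_].
  by rewrite subrK subrr; exact: homog1.
exact: homog0.
Qed.

Lemma homog_entry d x b (i j : 'I_(msize b)) :
  ghomog (M s) d x -> gA (d + mshift j - mshift i) (entry x i j).
Proof. by move=> /(_ b i j). Qed.

Lemma munitM b (i j l : 'I_(msize b)) : munit i j ** munit j l = munit i l.
Proof.
have := munit_corner i i j l (munit i j).
rewrite entry_munit !eqxx scale1r => <-; congr (_ ** _).
apply: entry_ext => c k m; rewrite entryM.
case: (b =P c) => [e|ne]; last first.
  by rewrite entry_munit_neq // big1 // => n _; rewrite entry_munit_neq ?mul0r.
subst c; rewrite (big_only1 i) // => [|n /negPf ni _]; last first.
  by rewrite entry_munit ni andbF mul0r.
by rewrite !entry_munit eqxx andbT; case: (k == i); rewrite ?mul1r ?mul0r.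
Qed.

Lemma munitM0 b (i j k l : 'I_(msize b)) : j != k -> munit i j ** munit k l = 0.
Proof.
move=> jk; rewrite -(munitM i j j) munit_corner entry_munit.
by rewrite eqxx [k == j]eq_sym (negPf jk) scale0r.
Qed.

Lemma munitM0_neq b b' (i j : 'I_(msize b)) (k l : 'I_(msize b')) :
  b <> b' -> munit i j ** munit k l = 0.
Proof. by move=> ne; rewrite -(munitM i j j); exact: munitM_neq. Qed.

Definition vertex := {b : 'I_(mblocks s) & 'I_(msize b)}.

Definition videm (v : vertex) : M s := munit (tagged v) (tagged v).

Definition vsum (K : {set vertex}) : M s := \sum_(v in K) videm v.

Lemma videmK v : videm v ** videm v = videm v.
Proof. exact: munitM. Qed.

Lemma videm_homog v : ghomog (M s) 0 (videm v).
Proof. by have := munit_homog (tagged v) (tagged v); rewrite subrr. Qed.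

Lemma videm_orth v w : v != w -> videm v ** videm w = 0.
Proof.
case: v w => b i [b' j]; rewrite /videm /=; case: (b =P b') => [e|ne] vw.
  by subst b'; apply: munitM0; apply: contraNneq vw => ->.
exact: munitM0_neq.
Qed.

Lemma big_vertex (R : Type) (idx : R) (op : Monoid.com_law idx)
    (F : forall b, 'I_(msize b) -> R) :
  \big[op/idx]_(v : vertex) F (tag v) (tagged v) =
  \big[op/idx]_b \big[op/idx]_(i < msize b) F b i.
Proof. by rewrite sig_big_dep. Qed.

(** Supplies the unit, which [galg] does not record; complements 1 - p are written [vsum setT - p]
    below. *)
Lemma vsum_full x : vsum setT ** x = x /\ x ** vsum setT = x.
Proof.
have -> : vsum setT = \sum_b \sum_(i < msize b) munit i i.
  rewrite /vsum (eq_bigl xpredT) => [|v]; last by rewrite inE.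
  exact: (big_vertex _ (fun b (i : 'I_(msize b)) => munit i i)).
have H b c (i j : 'I_(msize c)) :
    entry (\sum_b \sum_(i < msize b) munit i i : M s) i j = (i == j)%:R.
  rewrite entry_sum (big_only1 c) // => [|d /eqP ne _]; last first.
    by rewrite entry_sum big1 // => k _; rewrite entry_munit_neq.
  rewrite entry_sum (big_only1 i) // => [|k /negPf ne _]; last first.
    by rewrite entry_munit eq_sym ne.
  by rewrite entry_munit eqxx eq_sym.
split; apply: entry_ext => b i j; rewrite entryM.
  by rewrite (big_only1 i) // => [|k /negPf ne _];
    rewrite H ?eqxx ?mul1r // eq_sym ne mul0r.
by rewrite (big_only1 j) // => [|k /negPf ne _];
  rewrite H ?eqxx ?mulr1 // ne mulr0.
Qed.

Lemma vsum_videm (K : {set vertex}) v : v \in K -> below (videm v) (vsum K).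
Proof.
move=> vK; split; rewrite /vsum ?gmul_suml ?gmul_sumr (big_only1 v)
  ?videmK // => w wv _.
  exact: videm_orth.
by rewrite videm_orth // eq_sym.
Qed.

Lemma vsum_videm0 (K : {set vertex}) v : v \notin K -> orth (videm v) (vsum K).
Proof.
move=> vK; rewrite /orth /vsum gmul_suml gmul_sumr.
by split; apply: big1 => w wK; rewrite videm_orth //; apply: contraNneq vK;
  [move=> -> | move=> <-].
Qed.

Lemma vsum_disjoint (K L : {set vertex}) : [disjoint K & L] -> orth (vsum K)
  (vsum L).
Proof.
move=> KL; split; rewrite /vsum gmul_suml big1 // => v vK.
  by have [] := vsum_videm0 (negbT (disjointFr KL vK)).
by have [] := vsum_videm0 (negbT (disjointFl KL vK)).
Qed.

Lemma vsumU (K L : {set vertex}) : [disjoint K & L] -> vsum (K :|: L)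
  = vsum K + vsum L.
Proof.
by move=> KL; rewrite /vsum -bigU //; apply: eq_bigl => v; rewrite inE.
Qed.

Lemma vsum1 v : vsum [set v] = videm v.
Proof. by rewrite /vsum big_set1. Qed.

Lemma vsum0 : vsum set0 = 0.
Proof. by rewrite /vsum big_set0. Qed.

Lemma vsumD1 (K : {set vertex}) v : v \in K -> vsum K = videm v + vsum (K :\ v).
Proof. by move=> vK; rewrite /vsum (big_setD1 v vK). Qed.

Lemma vsum_homog K : ghomog (M s) 0 (vsum K).
Proof. by apply: homog_sum => v _; exact: videm_homog. Qed.

Lemma vsumK K : vsum K ** vsum K = vsum K.
Proof.
rewrite {1}/vsum gmul_suml; apply: eq_bigr => v vK.
by have [] := vsum_videm vK.
Qed.

Lemma vertex_corner_nz v w x :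
  videm v ** x ** videm w <> 0 ->
  exists b (i j : 'I_(msize b)), [/\ v = Tagged _ i, w = Tagged _ j
    & videm v ** x ** videm w = entry x i j *: munit i j].
Proof.
case: v w => b i [b' j]; case: (b =P b') => [e|ne].
  by subst b' => _; exists b, i, j; split=> //; exact: munit_corner.
by case; exact: munitM_neq.
Qed.

End Entries.

End MatrixUnits.

(** * Diagonalization of idempotents *)

Section Modes.
Variables (G : zmodType) (A : comPzRingType) (gA : ring_grading G A).

Local Notation M s := (matricial gA s).
Local Notation videm := (@videm _ _ gA _).
Local Notation vsum := (@vsum _ _ gA _).
Local Notation munit := (@munit _ _ gA _ _).

Definition relation_family := forall s : mshape G, M s -> M s -> Prop.

(* The two halves of the theorem are treated at once: sig relates x and y always
   when there is no involution, and when y = x* otherwise. The pairs (x, y) with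
   xy = p, yx = q and sig x y then witness the equivalence, resp. the
   *-equivalence, of p and q. *)
Record mode (sig : relation_family) : Prop := Mode {
  mode_adm : forall s, admissible (sig s);
  mode_munit : forall s b (i j : 'I_(@msize _ s b)), sig s (munit i j)
    (munit j i);
  mode_connect : forall s d (v w : vertex s),
    eqv anyrel d (videm v) (videm w) -> eqv (sig s) d (videm v) (videm w);
  mode_pivot : forall s (p f : M s) (v : vertex s),
    idem (sig s) p -> idem (sig s) f -> below p f -> below (videm v) f ->
    videm v ** p ** videm v <> 0 ->
    exists u u', eqv_pair (sig s) 0 f f u u' /\ below (u' ** videm v ** u) p;
  mode_extend : forall s t (g : M s -> M t), graded_alg_hom g ->
    (forall b (i j : 'I_(@msize _ s b)), sig t (g (munit i j)) (g (munit j i)))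
      ->
    forall x y, sig s x y -> sig t (g x) (g y)
}.

Hypothesis fA : graded_field gA.
Hypothesis A1 : (1 : A) <> 0.

Lemma videm_neq0 s (v : vertex s) : videm v <> 0.
Proof.
move=> /(congr1 (fun x => entry x (tagged v) (tagged v))).
by rewrite entry_munit entry0 !eqxx.
Qed.

Lemma corner_inverse s d (v w : vertex s) x : ghomog (M s) d x ->
  videm v ** x ** videm w <> 0 ->
  exists y, eqv_pair anyrel d (videm v) (videm w) (videm v ** x ** videm w) y.
Proof.
move=> hx nz; have [b [i [j [ev ew e]]]] := vertex_corner_nz nz.
set a := entry x i j in e; have ha := homog_entry i j hx; rewrite -/a in ha.
have a0 : a <> 0 by move=> a0; apply: nz; rewrite e a0 scale0r.
have [c hc ac] := homog_inverse fA ha a0.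
exists (c *: munit j i); rewrite e ev ew; split=> //.
- have := ghomogZ ha (munit_homog gA i j).
  by rewrite addrA subrK addrK.
- have := ghomogZ hc (munit_homog gA j i).
  by rewrite opprB addrC addrA subrK opprD addrC subrK.
- by rewrite -gscaleAl -gscaleAr scalerA ac scale1r munitM.
- by rewrite -gscaleAl -gscaleAr scalerA mulrC ac scale1r munitM.
- by rewrite -gscaleAr munitM.
- by rewrite -gscaleAr munitM.
Qed.

Section Mode.
Variables (sig : relation_family) (mS : mode sig).
Arguments sig : clear implicits.

Let adm s := mode_adm mS s.

Lemma idem_videm s (v : vertex s) : idem (sig s) (videm v).
Proof. by split; [exact: mode_munit|exact: videm_homog|exact: videmK]. Qed.

Lemma idem_vsum s (K : {set vertex s}) : idem (sig s) (vsum K).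
Proof.
split; [|exact: vsum_homog|exact: vsumK].
apply: (big_rec (fun x => sig s x x)) => [|v x _ hx]; first exact: ad0.
by apply: adD => //; exact: mode_munit.
Qed.

(** Induction on the size of J: a pivot conjugates p to an idempotent above one diagonal unit, which
    is then split off. The complement is tracked too, both because the proof exchanges p with it and
    because [eqv_upgrade] needs it. *)
Lemma diagonalize s (J : {set vertex s}) (p : M s) :
  idem (sig s) p -> below p (vsum J) ->
  exists K : {set vertex s}, [/\ K \subset J, eqv (sig s) 0 p (vsum K)
    & eqv (sig s) 0 (vsum J - p) (vsum (J :\: K))].
Proof.
elim: {J}_.+1 {-2}J (ltnSn #|J|) p => // n IH J; rewrite ltnS => Jn p ip pJ.
have [J0|[v vJ]] := set_0Vmem J.
  exists set0; have p0 : p = 0 by case: pJ => <- _; rewrite J0 vsum0 gmul0r.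
  by rewrite p0 J0 setDv vsum0 subr0; split=> //; exact: eqv00.
set e := videm v; set f := vsum J.
have ef : below e f by exact: vsum_videm.
have iF : idem (sig s) f by exact: idem_vsum.
have iE : idem (sig s) e by exact: idem_videm.
(* e p e and e (f - p) e add up to e <> 0, so one of them is nonzero. The second case is the first
   one for f - p, with K replaced by its complement in J. *)
suff main q : idem (sig s) q -> below q f -> e ** q ** e <> 0 ->
  exists K : {set vertex s}, [/\ K \subset J, eqv (sig s) 0 q (vsum K)
    & eqv (sig s) 0 (f - q) (vsum (J :\: K))].
  have [z|nz] := pselect (e ** p ** e = 0); last exact: main.
  have [|||K [KJ H1 H2]] := main (f - p).
  - exact: idemB.
  - by apply: belowB => //; exact: idem_any iF.
  - rewrite gmulBr gmulBl z subr0; case: ef => _ ->.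
    by rewrite videmK; exact: videm_neq0.
  exists (J :\: K); split; first exact: subsetDl.
  - by move: H2; rewrite opprB addrC subrK.
  by rewrite setDDr setDv set0U (setIidPr KJ).
move=> {p ip pJ} iq qf nz.
have [u [u' [H B]]] := mode_pivot mS iq iF qf ef nz.
have H' := eqv_pair_sym (adm s) H; rewrite oppr0 in H'.
have Hq := eqv_pair_restrict (adm s) H' iq qf.
(* u is a unit of the corner of f and u' e u lies below q, so e lies below the conjugate q1; what
   remains, q1 - e, lives on J without v. *)
set q1 := u ** q ** u' in Hq.
have eq1 : eqv (sig s) 0 q q1 by exists (q ** u'), (u ** q).
have iq1 := eqv_idemr (adm s) eq1.
have q1f : below q1 f.
  split; first by rewrite /q1 !gmulA (ep_pl H).
  by rewrite /q1 -gmulA (ep_rp H).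
have conjM x y : f ** y = y -> (u ** x ** u') ** (u ** y ** u') = u ** (x ** y)
  ** u'.
  by move=> fy; rewrite !gmulA -(gmulA (u ** x)) (ep_yx H) -(gmulA (u ** x)) fy.
set e' := u' ** e ** u in B; have [qe' e'q] := B.
have eE : e = u ** e' ** u'.
  by rewrite !gmulA (ep_xy H) -!gmulA (ep_xy H); case: ef => fe' ->.
have e'f : f ** e' = e' by rewrite !gmulA (ep_pr H).
have eq1b : below e q1.
  rewrite eE; split; rewrite conjM ?qe' ?e'q //.
  by case: qf.
have iq2 := idemB (adm s) iE iq1 eq1b.
have fe : vsum (J :\ v) = f - e by rewrite /f (vsumD1 _ vJ) addrC addKr.
have q2f : below (q1 - e) (vsum (J :\ v)).
  rewrite fe; case: ef eq1b q1f => [fe' ef'] [q1e eq1'] [fq1 q1f].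
  have ee : e ** e = e by exact: videmK.
  by split; rewrite gmulBl !gmulBr ?fq1 ?q1f ?fe' ?ef' ?eq1' ?q1e ee subrr
    subr0.
have [|K2 [K2J H1 H2]] := IH (J :\ v) _ _ iq2 q2f.
  by move: Jn; rewrite (cardsD1 v) vJ.
have vK2 : v \notin K2 by apply: contraL K2J => vK2; apply/subsetPn; exists v;
  rewrite // !inE eqxx.
exists (v |: K2); split.
- by rewrite subUset sub1set vJ (subset_trans K2J) // subsetDl.
- apply: (eqv_trans0 (adm s) eq1).
  have -> : q1 = e + (q1 - e) by rewrite addrC subrK.
  rewrite vsumU ?vsum1; last by rewrite disjoints1.
  apply: eqv_add => //.
  + exact: orthB (idem_any iE) eq1b.
  + exact: vsum_videm0.
  + exact: eqv_refl.
- have := eqv_pair_restrict (adm s) H' (idemB (adm s) iq iF qf)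
  (belowB (idem_any iF) qf).
  set r := u ** _ ** u' => Hr.
  have er : r = vsum (J :\ v) - (q1 - e).
    rewrite fe /r gmulBr gmulBl -/q1 opprB addrA subrK; congr (_ - _).
    by rewrite (ep_lq H) (ep_xy H).
  rewrite setDDl in H2; apply: (eqv_trans0 (adm s) _ H2); rewrite -er.
  by eexists; eexists; exact: Hr.
Qed.

End Mode.
End Modes.

(** * Matchings of diagonal units *)

Section Matching.
Variables (G : zmodType) (A : comPzRingType) (gA : ring_grading G A).
Hypotheses (fA : graded_field gA) (A1 : (1 : A) <> 0).

Local Notation M s := (matricial gA s).
Local Notation videm := (@videm _ _ gA _).
Local Notation vsum := (@vsum _ _ gA _).

(* Gaussian elimination: if the (k, l) corner d of x is invertible, with inverse
   z, then the Schur complement x - x z x of d has as inverse the complementary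
   block of y. *)
Lemma eqv_cancel s d (K L : {set vertex s}) k l (x y z : M s) :
  k \in K -> l \in L -> eqv_pair anyrel d (vsum K) (vsum L) x y ->
  eqv_pair anyrel d (videm k) (videm l) (videm k ** x ** videm l) z ->
  eqv anyrel d (vsum (K :\ k)) (vsum (L :\ l)).
Proof.
move=> kK lL H Hz; set e := videm k in Hz *; set e' := videm l in Hz *.
set f := vsum (K :\ k); set g := vsum (L :\ l).
have [eK Ke] : below e (vsum K) := vsum_videm gA kK.
have [eL Le] : below e' (vsum L) := vsum_videm gA lL.
have fE : f = vsum K - e by rewrite (vsumD1 _ kK) addrC addKr.
have gE : g = vsum L - e' by rewrite (vsumD1 _ lL) addrC addKr.
have ff : f ** f = f by exact: vsumK.
have gg : g ** g = g by exact: vsumK.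
have ee : e ** e = e by exact: videmK.
have ee' : e' ** e' = e' by exact: videmK.
have ef : e ** f = 0 by rewrite fE gmulBr Ke ee subrr.
have ge' : g ** e' = 0 by rewrite gE gmulBl eL ee' subrr.
have zf : z ** f = 0 by rewrite -(ep_rp Hz) -gmulA ef gmulr0.
have gz : g ** z = 0 by rewrite -(ep_pr Hz) gmulA ge' gmul0r.
have zxe' : z ** x ** e' = e'.
  by rewrite -{2}(ep_yx Hz) -[in LHS](ep_rp Hz) !gmulA.
have exz : e ** x ** z = e by rewrite -{2}(ep_xy Hz) -[in LHS](ep_pr Hz) !gmulA.
have fK : vsum K ** f = f by rewrite fE gmulBr eK vsumK.
have gL : vsum L ** g = g by rewrite gE gmulBr eL vsumK.
have fh : ghomog (M s) 0 f := vsum_homog _ _.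
have gh : ghomog (M s) 0 g := vsum_homog _ _.
have xL := ep_lq H; have xy := ep_xy H; have yx := ep_yx H.
exists (f ** (x - x ** z ** x) ** g), (g ** y ** f); split=> //.
- rewrite -[d]addr0; apply: ghomogM => //; rewrite -[d]add0r;
  apply: ghomogM => //.
  apply: homogB; first exact: ep_homl H.
  rewrite -[d]add0r -{1}(subrr d); apply: ghomogM (ep_homl H).
  exact: ghomogM (ep_homl H) (ep_homr Hz).
- rewrite -[- d]addr0; apply: ghomogM => //; rewrite -[- d]add0r.
  by apply: ghomogM => //; exact: ep_homr H.
- rewrite -!gmulA (gmulA g g) gg.
  have -> : (x - x ** (z ** x)) ** (g ** (y ** f)) = f.
    have xgyf : x ** (g ** (y ** f)) = f - x ** e' ** (y ** f).
      by rewrite gE gmulBl gmulBr !gmulA xL xy fK.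
    rewrite gmulBl -!gmulA xgyf !gmulBr !gmulA -(gmulA x z) zf gmulr0.
    by rewrite -!(gmulA x) zxe' sub0r opprK subrK.
  exact: ff.
- rewrite -!gmulA (gmulA f f) ff.
  have -> : y ** (f ** ((x - x ** (z ** x)) ** g)) = g - z ** (x ** g).
    have yfx : y ** (f ** x) = vsum L - y ** (e ** x).
      by rewrite fE gmulBl gmulBr !gmulA (ep_rp H) yx.
    have -> : (x - x ** (z ** x)) ** g = x ** (g - z ** (x ** g)).
      by rewrite gmulBl gmulBr !gmulA.
    rewrite (gmulA f) gmulA yfx gmulBl -(gmulA y).
    rewrite (_ : e ** x ** _ = 0); last by rewrite gmulBr !gmulA exz subrr.
    rewrite gmulr0 subr0 gmulBr gL !gmulA.
    by rewrite -[in vsum L ** z](ep_pr Hz) gmulA eL (ep_pr Hz).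
  by rewrite gmulBr gg gmulA gz gmul0r subr0.
- by rewrite !gmulA ff.
- by rewrite !gmulA gg.
Qed.

(** Matched pairs are removed one at a time by [eqv_cancel]. A permutation of all vertices, and not
    just a bijection from K to L, is produced so that in degree 0 the complements are matched as
    well. *)
Lemma eqv_matching s d (K L : {set vertex s}) : eqv anyrel d (vsum K) (vsum L)
  ->
  exists pi : {perm vertex s}, [/\ forall v, (pi v \in L) = (v \in K),
    forall v, v \in K -> eqv anyrel d (videm v) (videm (pi v))
    & d = 0 -> forall v, eqv anyrel 0 (videm v) (videm (pi v))].
Proof.
have iE (v : vertex s) : idem anyrel (videm v).
  by split=> //; [exact: videm_homog|exact: videmK].
have aE := @admissible_any _ _ _ (M s).
elim: {K}_.+1 {-2}K (ltnSn #|K|) L => // n IH K; rewrite ltnS => Kn L [x [y H]].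
have [K0|[k kK]] := set_0Vmem K.
  have L0 : L = set0.
    have [//|[l lL]] := set_0Vmem L; have [e _] := vsum_videm gA lL.
    case: (videm_neq0 (gA := gA) A1 (v := l)); rewrite -e -(ep_yx H) -(ep_pl H)
      K0.
    by rewrite vsum0 gmul0r gmulr0 gmul0r.
  exists 1%g; rewrite K0 L0; split=> [v|v|_ v]; rewrite ?perm1 ?inE //.
  exact: eqv_refl.
have [eK Ke] := vsum_videm gA kK.
(* If all these corners vanished, inserting [vsum L] between x and y in [videm k ** x ** y] would
   give [videm k] = 0. *)
have [l lL nz] : exists2 l, l \in L & videm k ** x ** videm l <> 0.
  apply: contrapT => none; apply: (videm_neq0 (gA := gA) A1 (v := k)).
  rewrite -(videmK gA k) -{1}Ke -(ep_xy H) -[x](ep_lq H)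
    !gmulA {1}/vsum gmul_sumr.
  rewrite !gmul_suml big1 // => l lL.
  rewrite (_ : _ ** videm l = 0) ?gmul0r //.
  by apply: contrapT => nz; apply: none; exists l.
have [z Hz] := corner_inverse fA (ep_homl H) nz.
have [|pi [piL pid pi0]] := IH (K :\ k) _ _ (eqv_cancel kK lL H Hz).
  by move: Kn; rewrite (cardsD1 k) kK.
have kl : eqv anyrel d (videm k) (videm l) by eexists; eexists; exact: Hz.
have pik : pi k \notin L :\ l by rewrite piL !inE eqxx.
have piK v : v \in K -> v != k -> (pi v != pi k) && (pi v != l).
  move=> vK vk; have : pi v \in L :\ l by rewrite piL !inE vk.
  by rewrite in_setD1 => /andP[-> _]; rewrite (inj_eq perm_inj) vk.
(* The transposition redirects k to l. The vertex v that pi sent to l now goes to pi k, and in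
   degree 0 this is justified by the chain v ~ l ~ k ~ pi k. *)
exists (pi * tperm (pi k) l)%g; split=> [v|v vK|d0 v]; rewrite permM.
- have [->|vk] := eqVneq v k; first by rewrite tpermL lL kK.
  have := piL v; rewrite !inE vk /=; case: tpermP => [/perm_inj e|vl|_ /eqP ->].
  + by rewrite e eqxx in vk.
  + rewrite vl eqxx /= => <-; apply/negbTE; move: pik.
    by rewrite !inE (_ : pi k != l) // -vl (inj_eq perm_inj) eq_sym.
  + by [].
- have [->|vk] := eqVneq v k; first by rewrite tpermL.
  have /andP[n1 n2] := piK v vK vk.
  by rewrite tpermD 1?eq_sym //; apply: pid; rewrite !inE vk.
- have kl0 : eqv anyrel 0 (videm k) (videm l) by rewrite -d0.
  have piv := pi0 d0; case: tpermP => [/perm_inj -> //|e|_ _]; last exact: piv.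
  apply: eqv_trans0 (piv k) => //; apply: eqv_trans0 (eqv_sym0 _ kl0) => //.
  by rewrite -e.
Qed.

Section Upgrade.
Variables (sig : relation_family gA) (mS : mode sig).
Arguments sig : clear implicits.
Let adm s := mode_adm mS s.

Lemma eqv_vsum_perm s d (K L : {set vertex s}) (pi : {perm vertex s}) :
  (forall v, (pi v \in L) = (v \in K)) ->
  (forall v, v \in K -> eqv anyrel d (videm v) (videm (pi v))) ->
  eqv (sig s) d (vsum K) (vsum L).
Proof.
move=> piL pid; have -> : vsum L = \sum_(v in K) videm (pi v).
  by rewrite /vsum (reindex_inj (@perm_inj _ pi)); exact: eq_bigl.
rewrite /vsum -!big_enum; apply: eqv_sum => //.
- exact: enum_uniq.
- by move=> v w _ _ vw; split; rewrite videm_orth // eq_sym.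
- by move=> v w _ _ vw; split; rewrite videm_orth // (inj_eq perm_inj)
  // eq_sym.
- by move=> v; rewrite mem_enum => /pid; exact: mode_connect.
Qed.

(** Equivalent projections are *-equivalent: p and q are diagonalized within the mode, and the
    diagonal units matched by the plain equivalence are reconnected by [mode_connect]. The clause on
    complements lets [conjugate] complete its equivalence to a unit. *)
Lemma eqv_upgrade s d (p q : M s) : idem (sig s) p -> idem (sig s) q ->
  eqv anyrel d p q -> eqv (sig s) d p q /\
  (d = 0 -> eqv (sig s) 0 (vsum setT - p) (vsum setT - q)).
Proof.
move=> ip iq pq.
have [K [_ pK pK']] := diagonalize A1 mS ip (vsum_full p).
have [L [_ qL qL']] := diagonalize A1 mS iq (vsum_full q).
have aE := @admissible_any _ _ _ (M s).
have KL : eqv anyrel d (vsum K) (vsum L).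
  rewrite -[d]add0r; apply: eqv_trans (eqv_sym0 aE (eqv_any pK)) _ => //.
  by rewrite -[d]addr0; apply: eqv_trans pq (eqv_any qL).
have [pi [piL pid pi0]] := eqv_matching KL.
split=> [|d0].
  rewrite -[d]add0r; apply: (eqv_trans (adm s) pK).
  rewrite -[d]addr0; apply: (eqv_trans (adm s) _ (eqv_sym0 (adm s) qL)).
  exact: (eqv_vsum_perm piL).
apply: (eqv_trans0 (adm s) pK').
apply: (eqv_trans0 (adm s) _ (eqv_sym0 (adm s) qL')).
by apply: (@eqv_vsum_perm _ _ _ _ pi) => v *; [rewrite !inE piL|exact: pi0].
Qed.

End Upgrade.
End Matching.

(** * Pivots without involution *)

Section TrivialMode.
Variables (G : zmodType) (A : comPzRingType) (gA : ring_grading G A).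
Hypothesis fA : graded_field gA.

Local Notation M s := (matricial gA s).
Local Notation videm := (@videm _ _ gA _).

Lemma mode_any : mode (fun s : mshape G => @anyrel _ _ _ (M s)).
Proof.
split=> // s p f v ip iF [fp pf] [fe ef] nz; set e := videm v in fe ef nz *.
have iE : idem anyrel e by split=> //; [exact: videm_homog|exact: videmK].
have [d' Hd] := corner_inverse fA (idem_homog ip) nz.
rewrite -/e in Hd; have dh := ep_homr Hd; rewrite oppr0 in dh.
have [[[_ hp pp] [_ hf ff]] [_ he ee]] := (ip, iF, iE).
have ed' : e ** d' = d' := ep_pr Hd; have d'e : d' ** e = d' := ep_rp Hd.
have epd' : e ** p ** d' = e by rewrite -{2}(ep_xy Hd) -!gmulA ed'.
have d'pe : d' ** p ** e = e by rewrite -{2}(ep_yx Hd) !gmulA d'e.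
have d'pd' : d' ** p ** d' = d' by rewrite -{2}ed' gmulA d'pe ed'.
have fd' : f ** d' = d' by rewrite -ed' gmulA fe.
(* With d = e p e and d' = d^-1, q = p d' p is an idempotent below p that is
   equivalent to e, and f - d' p inverts (f - e)(f - q), so 1 - q ~ 1 - e. *)
set q := p ** d' ** p.
have qp : below q p by rewrite /q; split; rewrite ?gmulA ?pp // -gmulA pp.
have qf : below q f by apply: below_trans qp (conj fp pf).
have h3 x y : ghomog (M s) 0 x -> ghomog (M s) 0 y -> ghomog (M s) 0 (x ** y).
  by move=> hx hy; rewrite -[0]addr0; exact: ghomogM.
have d'q : d' ** q = d' ** p by rewrite /q !gmulA d'pd'.
have qd'p : q ** d' ** p = q by rewrite /q -!gmulA (gmulA d' p) (gmulA _ d')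
  d'pd'.
have [pq qp'] := qp; have [fq qf'] := qf.
have qq : q ** q = q by rewrite {2}/q !gmulA qp' qd'p.
have iQ : idem anyrel q by split=> //; apply: (h3) => //; exact: h3.
pose Y := f - d' ** p; pose X := (f - e) ** (f - q).
have Ye : Y ** e = 0 by rewrite /Y gmulBl fe d'pe subrr.
have Yf : Y ** f = Y by rewrite /Y gmulBl ff -gmulA pf.
have fY : f ** Y = Y by rewrite /Y gmulBr ff gmulA fd'.
have eX : e ** X = 0 by rewrite /X gmulA (gmulBr f e) ef ee subrr gmul0r.
have qY : (f - q) ** Y = Y.
  by rewrite gmulBl fY /Y gmulBr qf' gmulA qd'p subrr subr0.
have HXY : eqv_pair anyrel 0 (f - e) (f - q) X Y.
  split=> //.
  - by apply: h3; apply: homogB => //; case: iQ.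
  - by rewrite oppr0; apply: homogB => //; exact: h3.
  - rewrite /X -gmulA qY gmulBl fY /Y gmulBr ef gmulA ed' opprB.
    by rewrite addrA subrK.
  - rewrite /X gmulA (gmulBr f e) Ye subr0 Yf /Y gmulBl !gmulBr ff fq.
    by rewrite -!gmulA pq d'q pf subrr subr0.
  - by rewrite /X gmulA gmulBl !gmulBr ff ef fe ee subrr subr0.
have Hq : eqv_pair anyrel 0 e q (e ** p) (p ** d').
  split=> //.
  - exact: h3.
  - by rewrite oppr0; exact: h3.
  - by rewrite gmulA -(gmulA e) pp epd'.
  - by rewrite gmulA -(gmulA p) d'e.
  - by rewrite gmulA ee.
  - by rewrite /q -!gmulA (gmulA p p) pp (gmulA d') d'pd'.
(* The sum of e ~ q and f - e ~ f - q. Since Y e = 0 and e X = 0, u' e u = p d' p = q, which lies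
   below p. *)
exists (e ** p + X), (p ** d' + Y); split.
  have := eqv_pair_add (@admissible_any _ _ _ (M s)) (orthB iE (conj fe ef))
    (orthB iQ qf) Hq HXY.
  by rewrite [e + _]addrC subrK [q + _]addrC subrK.
rewrite gmulDl Ye addr0 -gmulA gmulDr eX addr0 (gmulA e) ee gmulA -(gmulA p)
  d'e.
exact: qp.
Qed.

End TrivialMode.

(** * Linear extension of matrix units *)

Section UnitSystems.
Variables (G : zmodType) (A : comPzRingType) (gA : ring_grading G A).

Local Notation M s := (matricial gA s).
Local Notation munit := (@munit _ _ gA _ _).

(** Graded matrix units of shape s. The diagonal ones may sum to any idempotent, in accordance with
    non-unital homomorphisms; ring homomorphisms preserve such systems even when they are not
    A-linear. *)
Record unit_system (s : mshape G) (T : galg gA)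
    (F : forall b : 'I_(mblocks s), 'I_(msize b) -> 'I_(msize b) -> T) : Prop :=
  UnitSystem {
    us_homog : forall b (i j : 'I_(msize b)),
      ghomog T (mshift i - mshift j) (F b i j);
    us_mul : forall b (i j l : 'I_(msize b)), F b i j ** F b j l = F b i l;
    us_mul0 : forall b (i j k l : 'I_(msize b)),
      j != k -> F b i j ** F b k l = 0;
    us_neq : forall b b' (i j : 'I_(msize b)) (k l : 'I_(msize b')),
      b <> b' -> F b i j ** F b' k l = 0
  }.

Lemma unit_system_munit s :
  unit_system (fun b (i j : 'I_(@msize _ s b)) => munit i j).
Proof.
split; [exact: munit_homog|exact: munitM|exact: munitM0|exact: munitM0_neq].
Qed.

Lemma unit_system_map s (T U : galg gA)
    (F : forall b : 'I_(mblocks s), 'I_(msize b) -> 'I_(msize b) -> T)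
    (f : T -> U) :
  graded_ring_hom f -> unit_system F -> unit_system (fun b i j => f (F b i j)).
Proof.
move=> fh [Fh FM F0 Fn]; have f0 := hom0 fh; case: fh => fD fM fh.
split=> *; rewrite -?fM; first exact: fh.
- by rewrite FM.
- by rewrite F0.
- by rewrite Fn.
Qed.

Lemma unit_system_idem s (T : galg gA)
    (F : forall b : 'I_(mblocks s), 'I_(msize b) -> 'I_(msize b) -> T) b i :
  unit_system F -> idem anyrel (F b i i).
Proof.
by move=> [Fh FM _ _]; split=> //; rewrite -(subrr (mshift i)).
Qed.

Section LinearExtension.
Variables (s : mshape G) (T : galg gA).
Variable F : forall b : 'I_(mblocks s), 'I_(msize b) -> 'I_(msize b) -> T.
Hypothesis usF : unit_system F.

Definition lin_ext (x : M s) : T :=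
  \sum_b \sum_(i < msize b) \sum_(j < msize b) entry x i j *: F i j.

Lemma lin_extD : {morph lin_ext : x y / x + y}.
Proof.
move=> x y; rewrite /lin_ext -big_split; apply: eq_bigr => b _.
rewrite -big_split; apply: eq_bigr => i _; rewrite -big_split.
by apply: eq_bigr => j _; rewrite entryD scalerDl.
Qed.

Lemma lin_extZ a x : lin_ext (a *: x) = a *: lin_ext x.
Proof.
rewrite /lin_ext scaler_sumr; apply: eq_bigr => b _.
rewrite scaler_sumr; apply: eq_bigr => i _; rewrite scaler_sumr.
by apply: eq_bigr => j _; rewrite entryZ scalerA.
Qed.

Lemma lin_ext0 : lin_ext 0 = 0.
Proof. by apply: (addrI (lin_ext 0)); rewrite -lin_extD !addr0. Qed.

Lemma lin_ext_sum (I : Type) (r : seq I) (P : pred I) (E : I -> M s) :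
  lin_ext (\sum_(k <- r | P k) E k) = \sum_(k <- r | P k) lin_ext (E k).
Proof. exact: (big_morph _ lin_extD lin_ext0). Qed.

Lemma lin_ext_munitM b (i j : 'I_(msize b)) y :
  lin_ext (munit i j ** y) = F i j ** lin_ext y.
Proof.
have R : F i j ** lin_ext y = \sum_(l < msize b) entry y j l *: F i l.
  rewrite /lin_ext gmul_sumr (big_only1 b) // => [|c /eqP ne _].
    rewrite gmul_sumr (big_only1 j) // => [|k ne _].
      by rewrite gmul_sumr; apply: eq_bigr => l _; rewrite -gscaleAr us_mul.
    rewrite gmul_sumr big1 // => l _.
    by rewrite -gscaleAr (us_mul0 usF) ?scaler0 // eq_sym.
  rewrite gmul_sumr big1 // => k _; rewrite gmul_sumr big1 // => l _.
  by rewrite -gscaleAr (us_neq usF) ?scaler0 // => e; apply: ne.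
rewrite R /lin_ext (big_only1 b) // => [|c /eqP ne _]; last first.
  rewrite big1 // => k _; rewrite big1 // => l _.
  rewrite entryM big1 ?scale0r // => m _.
  by rewrite entry_munit_neq ?mul0r // => e; apply: ne.
rewrite (big_only1 i) // => [|k /negPf ne _].
  apply: eq_bigr => l _; rewrite entryM (big_only1 j) // => [|k /negPf ne _].
    by rewrite entry_munit !eqxx mul1r.
  by rewrite entry_munit ne andbF mul0r.
rewrite big1 // => l _; rewrite entryM big1 ?scale0r // => m _.
by rewrite entry_munit ne mul0r.
Qed.

Lemma lin_ext_hom : graded_alg_hom lin_ext.
Proof.
split; last exact: lin_extZ.
split; first exact: lin_extD.
- move=> x y; rewrite {1}(matricial_expand x) !gmul_suml lin_ext_sum.
  apply: eq_bigr => b _.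
  rewrite !gmul_suml lin_ext_sum; apply: eq_bigr => i _.
  rewrite !gmul_suml lin_ext_sum; apply: eq_bigr => j _.
  by rewrite -!gscaleAl lin_extZ lin_ext_munitM.
- move=> g x hx; apply: homog_sum => b _; apply: homog_sum => i _.
  apply: homog_sum => j _; have := ghomogZ (homog_entry i j hx)
    (us_homog usF i j).
  by rewrite addrA subrK addrK.
Qed.

Lemma lin_ext_munit b (i j : 'I_(msize b)) : lin_ext (munit i j) = F i j.
Proof.
rewrite /lin_ext (big_only1 b) // => [|c /eqP ne _]; last first.
  rewrite big1 // => k _; rewrite big1 // => l _.
  by rewrite entry_munit_neq ?scale0r // => e; apply: ne.
rewrite (big_only1 i) // => [|k /negPf ne _].
  rewrite (big_only1 j) // => [|k /negPf ne _].
    by rewrite entry_munit !eqxx scale1r.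
  by rewrite entry_munit ne andbF scale0r.
by rewrite big1 // => l _; rewrite entry_munit ne scale0r.
Qed.

End LinearExtension.

Lemma alg_hom_ext s (T : galg gA) (f g : M s -> T) :
  {morph f : x y / x + y} -> (forall a x, f (a *: x) = a *: f x) ->
  {morph g : x y / x + y} -> (forall a x, g (a *: x) = a *: g x) ->
  (forall b (i j : 'I_(@msize _ s b)), f (munit i j) = g (munit i j)) -> f =1 g.
Proof.
move=> fD fZ gD gZ fg x; rewrite (matricial_expand x).
have f0 : f 0 = 0 by rewrite -(scale0r 0) fZ scale0r.
have g0 : g 0 = 0 by rewrite -(scale0r 0) gZ scale0r.
rewrite (big_morph _ fD f0) (big_morph _ gD g0); apply: eq_bigr => b _.
rewrite (big_morph _ fD f0) (big_morph _ gD g0); apply: eq_bigr => i _.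
rewrite (big_morph _ fD f0) (big_morph _ gD g0); apply: eq_bigr => j _.
by rewrite fZ gZ fg.
Qed.

End UnitSystems.

(** * Rectification and conjugacy of homomorphisms *)

Section Rectify.
Variables (G : zmodType) (A : comPzRingType) (gA : ring_grading G A).
Hypotheses (fA : graded_field gA) (A1 : (1 : A) <> 0).

Local Notation M s := (matricial gA s).
Local Notation videm := (@videm _ _ gA _).
Local Notation vsum := (@vsum _ _ gA _).
Local Notation munit := (@munit _ _ gA _ _).

(** A Riesz decomposition: the first summand is transported into the corner of [vsum K] and
    diagonalized there on some K1; the remaining summands are then equivalent to the complement of
    K1 in K. *)
Lemma eqv_split s (I : eqType) (r : seq I) (P : I -> M s) (K : {set vertex s}) :
  uniq r -> {in r, forall i, idem anyrel (P i)} ->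
  {in r &, forall i j, i != j -> orth (P i) (P j)} ->
  eqv anyrel 0 (\sum_(i <- r) P i) (vsum K) ->
  exists Q : I -> {set vertex s},
  [/\ {in r, forall i, eqv anyrel 0 (P i) (vsum (Q i))},
      {in r, forall i, Q i \subset K}
    & {in r &, forall i j, i != j -> [disjoint Q i & Q j]}].
Proof.
have aE := @admissible_any _ _ _ (M s).
elim: r K => [|i r IH] K /=; first by exists (fun=> set0).
move=> /andP[ir ur] iP oP [x [y H]].
have sr : {subset r <= i :: r} by move=> j jr; rewrite inE jr orbT.
have iPi := iP i (mem_head _ _).
have orthPi : orth (P i) (\sum_(j <- r) P j).
  have ne j : j \in r -> i != j by apply: contraTneq => <-.
  split; rewrite ?gmul_suml ?gmul_sumr big_seq big1 // => j jr;
  by have [] := oP i j (mem_head _ _) (sr _ jr) (ne _ jr).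
rewrite big_cons in H; set S := \sum_(j <- r) P j in H orthPi.
have iS : idem anyrel S.
  apply: idem_sum => // [j k jr kr|j jr]; first exact: oP (sr _ jr) (sr _ kr).
  exact: iP (sr _ jr).
have HP := eqv_pair_restrict aE H iPi (belowDl iPi orthPi).
have HS := eqv_pair_restrict aE H iS (belowDr iS orthPi).
set p := y ** P i ** x in HP.
have eP : eqv anyrel 0 (P i) p by eexists; eexists; exact: HP.
have pK : below p (vsum K).
  by split; rewrite /p ?gmulA ?(ep_pr H) // -gmulA (ep_lq H).
have [K1 [K1K pK1 pK1']] := diagonalize A1 (mode_any fA) (eqv_idemr aE eP) pK.
have eS : eqv anyrel 0 S (vsum (K :\: K1)).
  apply: (eqv_trans0 aE _ pK1').
  have -> : vsum K - p = y ** S ** x.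
    rewrite -(ep_yx H) -[x in LHS](ep_pl H) gmulDl gmulDr !gmulA addrC addKr.
    by [].
  by eexists; eexists; exact: HS.
have [||Q [PQ QK dQ]] := IH _ ur _ _ eS.
- by move=> j jr; exact: iP (sr _ jr).
- by move=> j k jr kr; exact: oP (sr _ jr) (sr _ kr).
have ne j : j \in r -> j != i by apply: contraTneq => ->.
have dK1 j : j \in r -> [disjoint K1 & Q j].
  move=> jr; rewrite disjoint_sym; apply: disjointWl (QK _ jr) _.
  by rewrite -setI_eq0 setIC setIDA setDIl setDv set0I.
exists (fun j => if j == i then K1 else Q j); split.
- move=> j; rewrite inE; case: eqP => [->|_ /PQ //] _.
  exact: eqv_trans0 eP pK1.
- move=> j; rewrite inE; case: eqP => // _ /QK jK.
  exact: subset_trans jK (subsetDl _ _).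
- move=> j k; rewrite !inE; case: (eqVneq j i) => [->|ji] /=.
    by case: (eqVneq k i) => [->|ki] /=; [|move=> _ /dK1].
  case: (eqVneq k i) => [->|ki] /= jr; first by rewrite disjoint_sym => _ _;
    exact: dK1.
  exact: dQ.
Qed.

(** * Homomorphisms determined by their diagonal units up to conjugation *)

Section Mode.
Variables (sig : relation_family gA) (mS : mode sig).
Arguments sig : clear implicits.
Let adm s := mode_adm mS s.

(** Equivalences chosen separately for all pairs need not compose coherently. Routing all of them
    through index 0, as x_i y_j, forces the matrix unit relations. *)
Lemma unit_block t n (e : 'I_n -> M t) (g : 'I_n -> G) :
  (forall i j, eqv (sig t) (g i - g j) (e i) (e j)) ->
  exists F : 'I_n -> 'I_n -> M t,
  [/\ forall i j, ghomog (M t) (g i - g j) (F i j),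
    forall i j l, F i j ** F j l = F i l, forall i, F i i = e i
    & forall i j, sig t (F i j) (F j i)].
Proof.
case: n e g => [|n] e g H; first by exists (fun _ _ => 0); split; case.
have [x /choice[y xy]] := choice (fun i => H i ord0).
exists (fun i j => x i ** y j); split=> [i j|i j l|i|i j].
- have := ghomogM (ep_homl (xy i)) (ep_homr (xy j)).
  by rewrite opprB addrA subrK.
- by rewrite gmulA -(gmulA (x i)) (ep_yx (xy j)) (ep_lq (xy i)).
- exact: ep_xy (xy i).
- by apply: (adM (adm t)); [exact: ep_ad (xy i)|apply: (adC (adm t));
  exact: ep_ad (xy j)].
Qed.

(** In the *-case this replaces an algebra homomorphism by a *-homomorphism with the same effect on
    classes of diagonal units: the images of these are exchanged for sums of diagonal units of M t,
    which are projections. *)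
Lemma rectify s t (h : M s -> M t) : graded_alg_hom h ->
  exists h' : M s -> M t, [/\ graded_alg_hom h',
    forall x y, sig s x y -> sig t (h' x) (h' y)
    & forall b (i : 'I_(@msize _ s b)),
        eqv anyrel 0 (h' (munit i i)) (h (munit i i))].
Proof.
move=> hh; have [hr _] := hh; have aE := @admissible_any _ _ _ (M t).
have usH := unit_system_map hr (unit_system_munit gA s).
pose P (v : vertex s) := h (videm v).
have oP (v w : vertex s) : v != w -> orth (P v) (P w).
  by move=> vw; split; rewrite /P -(homM hr) videm_orth ?(hom0 hr) // eq_sym.
have iP (v : vertex s) : idem anyrel (P v) by exact: unit_system_idem usH.
have iS : idem anyrel (\sum_(v <- enum {: vertex s}) P v).
  apply: idem_sum => //; first exact: enum_uniq.
  by move=> v w _ _; exact: oP.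
(* The idempotents P v are diagonalized through their sum and not one by one, because the sets Q v
   have to be disjoint. *)
have [K [_ HK _]] := diagonalize A1 (mode_any fA) iS (vsum_full _).
have [Q [PQ _ dQ]] := eqv_split (enum_uniq _) (fun v _ => iP v)
  (fun v w _ _ => @oP v w) HK.
have {}PQ v : eqv anyrel 0 (P v) (vsum (Q v)) by apply: PQ; rewrite mem_enum.
have {}dQ v w : v != w -> [disjoint Q v & Q w] by apply: dQ; rewrite mem_enum.
have blk b : exists F : 'I_(@msize _ s b) -> 'I_(msize b) -> M t,
  [/\ forall i j, ghomog (M t) (mshift i - mshift j) (F i j),
    forall i j l, F i j ** F j l = F i l,
    forall i, F i i = vsum (Q (Tagged _ i))
    & forall i j, sig t (F i j) (F j i)].
  apply: unit_block => i j; apply: (eqv_upgrade fA A1 mS _ _ _).1.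
  - exact: idem_vsum.
  - exact: idem_vsum.
  rewrite -[_ - _]add0r; apply: (eqv_trans aE (eqv_sym0 aE (PQ _))).
  rewrite -[_ - _]addr0; apply: (eqv_trans aE _ (PQ _)).
  exists (h (munit i j)), (h (munit j i)); case: usH => Hh HM _ _.
  by split; rewrite ?HM ?opprB.
pose F b := projT1 (cid (blk b)).
have FP b : [/\ forall i j, ghomog (M t) (mshift i - mshift j) (F b i j),
    forall i j l, F b i j ** F b j l = F b i l,
    forall i, F b i i = vsum (Q (Tagged _ i))
    & forall i j, sig t (F b i j) (F b j i)] := projT2 (cid (blk b)).
have usF : unit_system F.
  split=> [b i j|b i j l|b i j k l jk|b b' i j k l bb'].
  - by have [Fh _ _ _] := FP b; exact: Fh.
  - by have [_ FM _ _] := FP b; exact: FM.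
  - have [_ FM Fe _] := FP b; rewrite -(FM i j j) -(FM k k l) !Fe.
    rewrite gmulA -(gmulA (F b i j)) (proj1 (vsum_disjoint _ _))
      ?gmulr0 ?gmul0r //.
    by apply: dQ; rewrite eq_Tagged.
  - have [_ FM Fe _] := FP b; have [_ FM' Fe' _] := FP b'.
    rewrite -(FM i j j) -(FM' k k l) Fe Fe'.
    rewrite gmulA -(gmulA (F b i j)) (proj1 (vsum_disjoint _ _))
      ?gmulr0 ?gmul0r //.
    by apply: dQ; apply/eqP => -[].
exists (lin_ext F); have lh := lin_ext_hom usF; split=> //.
  apply: (mode_extend mS) => // b i j; rewrite !lin_ext_munit.
  by have [_ _ _ Fs] := FP b; exact: Fs.
move=> b i; rewrite lin_ext_munit; have [_ _ -> _] := FP b.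
exact: eqv_sym0 (PQ (Tagged _ i)).
Qed.

(** One equivalence w of the corners at index 0 is spread along the matrix units: x_i = F_i0 w E_0i.
    The common degrees g i - g j make every x_i of degree 0. *)
Lemma conjugate_block t n (E F : 'I_n -> 'I_n -> M t) :
  (forall i j l, E i j ** E j l = E i l) -> (forall i j l,
    F i j ** F j l = F i l) ->
  (forall i j, sig t (E i j) (E j i)) -> (forall i j, sig t (F i j) (F j i)) ->
  (exists g : 'I_n -> G, forall i j, ghomog (M t) (g i - g j) (E i j) /\
    ghomog (M t) (g i - g j) (F i j)) ->
  (forall i, eqv (sig t) 0 (F i i) (E i i)) ->
  exists x y : 'I_n -> M t,
    (forall i, eqv_pair (sig t) 0 (F i i) (E i i) (x i) (y i)) /\
    (forall i j, x i ** E i j ** y j = F i j).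
Proof.
case: n E F => [|n] E F EM FM sE sF [g hg] H.
  by exists (fun=> 0), (fun=> 0); split; case.
have [w [w' W]] := H ord0.
exists (fun i => F i ord0 ** w ** E ord0 i), (fun i =>
  E i ord0 ** w' ** F ord0 i).
have key i j k : F i ord0 ** w ** E ord0 j ** (E j ord0 ** w' ** F ord0 k)
  = F i k.
  rewrite !gmulA -(gmulA _ (E ord0 j)) EM -(gmulA (F i ord0) w).
  by rewrite (ep_lq W) -(gmulA _ w) (ep_xy W) !FM.
split=> [i|i j]; last by rewrite -(gmulA _ (E ord0 i)) EM; exact: key.
have hx (X Y Z : M t) : ghomog (M t) (g i - g ord0) X -> ghomog (M t) 0 Y ->
    ghomog (M t) (g ord0 - g i) Z -> ghomog (M t) 0 (X ** Y ** Z).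
  move=> hX hY hZ; have := ghomogM (ghomogM hX hY) hZ.
  by rewrite addr0 addrA subrK subrr.
split.
- rewrite -gmulA; apply: (adM (adm t)); last by apply: (adM (adm t));
  [exact: ep_ad W|exact: sE].
  exact: sF.
- by apply: hx; [exact: (hg _ _).2|exact: ep_homl W|exact: (hg _ _).1].
- rewrite oppr0; apply: hx; [exact: (hg _ _).1| |exact: (hg _ _).2].
  by have := ep_homr W; rewrite oppr0.
- exact: key.
- rewrite !gmulA -(gmulA _ (F ord0 i)) FM -(gmulA (E i ord0) w').
  by rewrite (ep_rp W) -(gmulA _ w') (ep_yx W) !EM.
- by rewrite !gmulA FM.
- by rewrite !gmulA EM.
Qed.

(** The elements of [conjugate_block], summed over all vertices, carry f to g between the corners of
    f(1) and g(1); an equivalence of the complements, which f and g do not see, completes the sum to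
    a unit. *)
Lemma conjugate s t (f g : M s -> M t) : graded_alg_hom f -> graded_alg_hom g ->
  (forall x y, sig s x y -> sig t (f x) (f y)) ->
  (forall x y, sig s x y -> sig t (g x) (g y)) ->
  (forall b (i : 'I_(@msize _ s b)),
     eqv anyrel 0 (g (munit i i)) (f (munit i i))) ->
  exists u u', eqv_pair (sig t) 0 (vsum setT) (vsum setT) u u' /\
    forall x, u ** f x ** u' = g x.
Proof.
move=> hf hg sf sg fg; have [[fr fZ] [gr gZ]] := (hf, hg).
have usf := unit_system_map fr (unit_system_munit gA s).
have usg := unit_system_map gr (unit_system_munit gA s).
have blk b : exists xy : ('I_(@msize _ s b) -> M t) * ('I_(msize b) -> M t),
    (forall i, eqv_pair (sig t) 0 (g (munit i i)) (f (munit i i)) (xy.1 i)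
      (xy.2 i)) /\
    (forall i j, xy.1 i ** f (munit i j) ** xy.2 j = g (munit i j)).
  have [||||||x [y xy]] := @conjugate_block t (@msize _ s b) (fun i j =>
    f (munit i j))
    (fun i j => g (munit i j)); last by exists (x, y).
  - exact: (us_mul usf).
  - exact: (us_mul usg).
  - by move=> i j; apply: sf; exact: mode_munit.
  - by move=> i j; apply: sg; exact: mode_munit.
  - exists (@mshift _ s b) => i j; split; [exact: (us_homog usf)|exact:
    (us_homog usg)].
  - move=> i; apply: (eqv_upgrade fA A1 mS _ _ (fg b i)).1.
      split; [by apply: sg; exact: mode_munit|exact: (idem_homog
        (unit_system_idem i usg))|].
      exact: (us_mul usg).
    split; [by apply: sf; exact: mode_munit|exact: (idem_homog
      (unit_system_idem i usf))|].
    exact: (us_mul usf).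
pose X (v : vertex s) := (projT1 (cid (blk (tag v)))).1 (tagged v).
pose Y (v : vertex s) := (projT1 (cid (blk (tag v)))).2 (tagged v).
have XYP (v : vertex s) : eqv_pair (sig t) 0 (g (videm v)) (f (videm v)) (X v)
  (Y v).
  by have [H _] := projT2 (cid (blk (tag v))); exact: H.
have XYg b (i j : 'I_(msize b)) :
    X (Tagged _ i) ** f (munit i j) ** Y (Tagged _ j) = g (munit i j).
  by have [_ H] := projT2 (cid (blk b)); exact: H.
have orthH (h : M s -> M t) (hr : graded_ring_hom h) (v w : vertex s) :
    v != w -> orth (h (videm v)) (h (videm w)).
  by move=> vw; split; rewrite -(homM hr) videm_orth ?(hom0 hr) // eq_sym.
have H := eqv_pair_sum (adm t) (enum_uniq [set: vertex s])
  (fun v w _ _ => @orthH _ gr v w) (fun v w _ _ => @orthH _ fr v w) (fun v _ =>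
    XYP v).
rewrite !big_enum -!hom_sum // -/(vsum setT) in H.
set U := \sum_(v in setT) X v in H; set U' := \sum_(v in setT) Y v in H.
have eH : eqv (sig t) 0 (g (vsum setT)) (f (vsum setT)) by exists U, U'.
have iF := eqv_idemr (adm t) eH; have iG := eqv_idem (adm t) eH.
(* Cancellation: g(1) ~ f(1) implies 1 - g(1) ~ 1 - f(1). *)
have [_ /(_ erefl)[z [z' Z]]] := eqv_upgrade fA A1 mS iG iF (eqv_any eH).
have oB p : idem (sig t) p -> orth p (vsum setT - p).
  by move=> ip; apply: orthB (idem_any ip) (vsum_full p).
have := eqv_pair_add (adm t) (oB _ iG) (oB _ iF) H Z.
rewrite ![_ + (vsum setT - _)]addrC !subrK => HZ; exists (U + z), (U' + z').
split=> //; apply: alg_hom_ext => //.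
- by move=> x y; rewrite (homD fr) gmulDr gmulDl.
- by move=> a x; rewrite fZ -gscaleAr -gscaleAl.
- by move=> x y; rewrite (homD gr).
have zf x : z ** f x = 0.
  have [e _] := vsum_full x; rewrite -[z](ep_lq Z) -e (homM fr)
    gmulA -(gmulA z).
  by rewrite gmulBl (idemK iF) (proj1 (vsum_full _)) subrr gmulr0 gmul0r.
have fz x : f x ** z' = 0.
  have [_ e] := vsum_full x; rewrite -[z'](ep_pr Z) -e (homM fr)
    -gmulA (gmulA _ _ z').
  by rewrite gmulBr (idemK iF) (proj2 (vsum_full _)) subrr gmul0r gmulr0.
move=> b i j; rewrite gmulDl zf addr0 gmulDr -(gmulA U _ z')
  fz gmulr0 addr0 -XYg.
have eij : munit i j = videm (Tagged _ i) ** munit i j ** videm (Tagged _ j).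
  by rewrite /videm !munitM.
rewrite [U ** _]gmul_suml (big_only1 (Tagged _ i)) ?inE // => [|v vi _].
  rewrite gmul_sumr (big_only1 (Tagged _ j)) ?inE // => v vj _.
  rewrite -(ep_pr (XYP v)) gmulA -(gmulA _ _ (f (videm v))) -(homM fr) eij.
  by rewrite -(gmulA _ _ (videm v)) videm_orth 1?eq_sym // gmulr0 (hom0 fr)
    gmulr0 gmul0r.
rewrite -(ep_lq (XYP v)) -gmulA -(homM fr) eij -!gmulA (gmulA (videm v)).
by rewrite videm_orth // gmul0r (hom0 fr) gmulr0.
Qed.

End Mode.
End Rectify.

(** * Intertwining *)

Section Limits.
Variables (G : zmodType) (A : comPzRingType) (gA : ring_grading G A).
Hypotheses (fA : graded_field gA) (A1 : (1 : A) <> 0).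
Variables (sig : relation_family gA) (mS : mode sig).
Arguments sig : clear implicits.

Local Notation M s := (matricial gA s).
Local Notation munit := (@munit _ _ gA _ _).
Local Notation videm := (@videm _ _ gA _).
Local Notation vsum := (@vsum _ _ gA _).

Let adm s := mode_adm mS s.

(* L is the direct limit of the M (lim_shape n), expressed by the properties
   that characterize it. *)
Record limit_of (L : galg gA) := LimitOf {
  lim_shape : nat -> mshape G;
  lim_in : forall n, M (lim_shape n) -> L;
  lim_tr : forall n m, M (lim_shape n) -> M (lim_shape m);
  lim_in_hom : forall n, graded_alg_hom (@lim_in n);
  lim_tr_hom : forall n m, (n <= m)%N -> graded_alg_hom (@lim_tr n m);
  lim_tr_sig : forall n m x y, (n <= m)%N -> sig _ x y ->
    sig _ (@lim_tr n m x) (@lim_tr n m y);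
  lim_in_tr : forall n m x, (n <= m)%N -> lim_in (@lim_tr n m x) = lim_in x;
  lim_tr_id : forall n x, @lim_tr n n x = x;
  lim_tr_tr : forall n m p x, (n <= m)%N -> (m <= p)%N ->
    @lim_tr m p (@lim_tr n m x) = @lim_tr n p x;
  lim_surj : forall x, exists n a, x = @lim_in n a;
  lim_lift : forall g x, ghomog L g x ->
    exists n a, ghomog _ g a /\ x = @lim_in n a;
  lim_eq : forall n x y, @lim_in n x = @lim_in n y ->
    exists2 m, (n <= m)%N & @lim_tr n m x = @lim_tr n m y
}.

Definition eventually (P : nat -> Prop) : Prop :=
  exists N, forall n, (N <= n)%N -> P n.

Lemma eventually_ge k : eventually (fun n => k <= n)%N.
Proof. by exists k. Qed.

Lemma eventuallyI P Q : eventually P -> eventually Q ->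
  eventually (fun n => P n /\ Q n).
Proof.
move=> [N HN] [N' HN']; exists (maxn N N') => n; rewrite geq_max => /andP[h h'].
by split; [exact: HN|exact: HN'].
Qed.

Lemma eventually_mono (P Q : nat -> Prop) :
  (forall n, P n -> Q n) -> eventually P -> eventually Q.
Proof. by move=> PQ [N HN]; exists N => n /HN /PQ. Qed.

Lemma eventually_all (I : finType) (P : I -> nat -> Prop) :
  (forall i, eventually (P i)) -> eventually (fun n => forall i, P i n).
Proof.
move=> /choice[N HN]; exists (\max_i N i) => n nN i; apply: HN.
exact: leq_trans (leq_bigmax i) nN.
Qed.

Lemma eventually_witness P : eventually P -> exists n, P n.
Proof. by move=> [N HN]; exists N; exact: HN. Qed.

Section OneLimit.
Variables (L : galg gA) (lL : limit_of L).
Local Notation tr n m := (@lim_tr _ lL n m).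

Lemma lim_ev n x y : @lim_in _ lL n x = lim_in y ->
  eventually (fun m => tr n m x = tr n m y).
Proof.
move=> /lim_eq[k nk e]; exists k => m km.
by rewrite -(lim_tr_tr _ nk km) e (lim_tr_tr _ nk km).
Qed.

Lemma lim_ev2 n n' x y : @lim_in _ lL n x = @lim_in _ lL n' y ->
  eventually (fun m => tr n m x = tr n' m y).
Proof.
pose k := maxn n n'; have nk : (n <= k)%N := leq_maxl _ _.
have nk' : (n' <= k)%N := leq_maxr _ _.
rewrite -(lim_in_tr x nk) -(lim_in_tr y nk') => /lim_ev H.
apply: eventually_mono (eventuallyI (eventually_ge k) H) => m [km].
by rewrite !lim_tr_tr.
Qed.

Lemma lim_lift_ev g x : ghomog L g x -> eventually (fun n =>
  exists a : M (lim_shape lL n), ghomog _ g a /\ x = lim_in a).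
Proof.
move=> /(lim_lift lL)[n [a [ha ->]]]; exists n => m nm.
exists (tr n m a); split; last by rewrite lim_in_tr.
exact: hom_homog (lim_tr_hom lL nm).1 ha.
Qed.

(** An equivalence consists of two homogeneous elements and four equations, all of which hold from
    some stage on. *)
Lemma lift_eqv n p q : eqv anyrel 0 (@lim_in _ lL n p) (lim_in q) ->
  eventually (fun m => eqv anyrel 0 (tr n m p) (tr n m q)).
Proof.
move=> [x [y [_ hx hy xy yx px qy]]].
have [k [nk [[a [ha xa]] [b [hb yb]]]]] := eventually_witness
  (eventuallyI (eventually_ge n) (eventuallyI (lim_lift_ev hx)
    (lim_lift_ev hy))).
have inM : {morph @lim_in _ lL k : u v / u ** v} := homM (lim_in_hom lL k).1.
have E1 : eventually (fun m => tr k m (a ** b) = tr k m (tr n k p)).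
  by apply: lim_ev; rewrite inM -xa -yb xy lim_in_tr.
have E2 : eventually (fun m => tr k m (b ** a) = tr k m (tr n k q)).
  by apply: lim_ev; rewrite inM -xa -yb yx lim_in_tr.
have E3 : eventually (fun m => tr k m (tr n k p ** a) = tr k m a).
  by apply: lim_ev; rewrite inM -xa lim_in_tr.
have E4 : eventually (fun m => tr k m (tr n k q ** b) = tr k m b).
  by apply: lim_ev; rewrite inM -yb lim_in_tr.
apply: eventually_mono (eventuallyI (eventually_ge k)
  (eventuallyI (eventuallyI E1 E2) (eventuallyI E3 E4))).
move=> m [km [[e1 e2] [e3 e4]]]; have [th _] := lim_tr_hom lL km.
exists (tr k m a), (tr k m b); rewrite -(lim_tr_tr p nk km)
  -(lim_tr_tr q nk km).
by split=> //; rewrite -?(homM th) //; exact: hom_homog th _.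
Qed.

Lemma lift_unit_system (s : mshape G)
    (F : forall b : 'I_(mblocks s), 'I_(msize b) -> 'I_(msize b) -> L) :
  unit_system F -> eventually (fun n =>
    exists F' : forall b : 'I_(mblocks s), 'I_(msize b) -> 'I_(msize b) ->
        M (lim_shape lL n),
      unit_system F' /\ forall b i j, lim_in (F' b i j) = F b i j).
Proof.
move=> usF; have [Fh FM F0 Fn] := usF.
pose J := {b : 'I_(mblocks s) & ('I_(msize b) * 'I_(msize b))%type}.
have [n /choice[a Ha]] := eventually_witness (eventually_all
  (fun t : J => lim_lift_ev (Fh (tag t) (tagged t).1 (tagged t).2))).
pose E (b : 'I_(mblocks s)) (i j : 'I_(msize b)) : M (lim_shape lL n) :=
  a (Tagged _ (i, j) : J).
have Eh b i j : ghomog _ (mshift i - mshift j) (E b i j).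
  by have [h _] := Ha (Tagged _ (i, j) : J).
have EF b i j : lim_in (E b i j) = F b i j.
  by have [_ /esym] := Ha (Tagged _ (i, j) : J).
have inM : {morph @lim_in _ lL n : u v / u ** v} := homM (lim_in_hom lL n).1.
have in0 := hom0 (lim_in_hom lL n).1.
have e1 : eventually (fun m =>
    forall (t : {b : 'I_(mblocks s) & ('I_(msize b) * 'I_(msize b)
      * 'I_(msize b))%type}),
    tr n m (E _ (tagged t).1.1 (tagged t).1.2 ** E _ (tagged t).1.2 (tagged
      t).2) =
    tr n m (E _ (tagged t).1.1 (tagged t).2)).
  by apply: eventually_all => t; apply: lim_ev; rewrite inM !EF FM.
(* The right-hand side is [tr n m 0] and not 0 because [tr n m] is known to be additive only once n
   <= m. *)
have e2 : eventually (fun m =>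
    forall (t : {b : 'I_(mblocks s) &
      ('I_(msize b) * 'I_(msize b) * ('I_(msize b) * 'I_(msize b)))%type}),
    (tagged t).1.2 != (tagged t).2.1 ->
    tr n m (E _ (tagged t).1.1 (tagged t).1.2 ** E _ (tagged t).2.1 (tagged
      t).2.2) =
    tr n m 0).
  apply: eventually_all => t; case: eqVneq => [_|ne]; first by exists 0%N.
  suff : eventually (fun m => tr n m (E _ (tagged t).1.1 (tagged t).1.2 **
    E _ (tagged t).2.1 (tagged t).2.2) = tr n m 0) by exact: eventually_mono.
  by apply: lim_ev; rewrite inM !EF F0.
have e3 : eventually (fun m => forall t : J * J, tag t.1 <> tag t.2 ->
    tr n m (E _ (tagged t.1).1 (tagged t.1).2 ** E _ (tagged t.2).1 (tagged
      t.2).2) =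
    tr n m 0).
  apply: eventually_all => t; case: (tag t.1 =P tag t.2) => [e|ne].
    by exists 0%N.
  suff : eventually (fun m => tr n m (E _ (tagged t.1).1 (tagged t.1).2 **
    E _ (tagged t.2).1 (tagged t.2).2) = tr n m 0) by exact: eventually_mono.
  by apply: lim_ev; rewrite inM !EF Fn.
apply: eventually_mono (eventuallyI (eventually_ge n)
  (eventuallyI e1 (eventuallyI e2 e3))) => m [nm [H1 [H2 H3]]].
have [th _] := lim_tr_hom lL nm; have t0 := hom0 th.
exists (fun b i j => tr n m (E b i j)); split=> [|b i j];
  last by rewrite lim_in_tr.
split=> [b i j|b i j l|b i j k l jk|b b' i j k l bb'].
- exact: hom_homog th (Eh _ _ _).
- by rewrite -(homM th) (H1 (Tagged _ (i, j, l))).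
- by rewrite -(homM th) -[RHS]t0; exact: (H2 (Tagged _ (i, j, (k, l)))).
- by rewrite -(homM th) -[RHS]t0; exact: (H3 (Tagged _ (i, j), Tagged _ (k,
  l))).
Qed.

End OneLimit.

Section TwoLimits.
Variables (X Y : galg gA) (lX : limit_of X) (lY : limit_of Y).

(** What is left of K-theory: f and g induce the same map on classes of diagonal units, to which
    [diagonalize] reduces all idempotents of degree 0. *)
Definition compatible (f : X -> Y) n m
    (g : M (lim_shape lX n) -> M (lim_shape lY m)) : Prop :=
  forall b (i : 'I_(@msize _ _ b)),
    eqv anyrel 0 (lim_in (g (munit i i))) (f (lim_in (munit i i))).

Definition sig_preserving s t (g : M s -> M t) : Prop :=
  forall x y, sig s x y -> sig t (g x) (g y).

Lemma approximate (f : X -> Y) n : graded_ring_hom f -> eventually (fun m =>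
  exists g : M (lim_shape lX n) -> M (lim_shape lY m),
    [/\ graded_alg_hom g, sig_preserving g & compatible f g]).
Proof.
move=> fh; have [inh _] := lim_in_hom lX n.
have usF := unit_system_map fh (unit_system_map inh (unit_system_munit gA _)).
apply: eventually_mono (lift_unit_system lY usF) => m [F [us FE]].
have [g [gh gs ge]] := rectify fA A1 mS (lin_ext_hom us).
exists g; split=> // b i; rewrite -FE -(lin_ext_munit F).
apply: eqv_any_map (ge b i); exact: (lim_in_hom lY m).1.
Qed.

End TwoLimits.

(** One commuting triangle. Compatibility of the new map is part of the conclusion, so that the
    lemma applies again with X and Y, f and f' exchanged. *)
Lemma half_step (X Y : galg gA) (lX : limit_of X) (lY : limit_of Y)
    (f : X -> Y) (f' : Y -> X) n m
    (g : M (lim_shape lX n) -> M (lim_shape lY m)) N :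
  graded_ring_hom f' -> cancel f f' ->
  graded_alg_hom g -> sig_preserving g -> compatible f g ->
  exists n' (h : M (lim_shape lY m) -> M (lim_shape lX n')),
    [/\ (n <= n')%N, (N <= n')%N, forall x, h (g x) = lim_tr n' x,
        graded_alg_hom h & sig_preserving h /\ compatible f' h].
Proof.
move=> f'h fK gh gs gc; have [gr _] := gh.
have [n1 [nn1 [h [hh hs hc]]]] := eventually_witness
  (eventuallyI (eventually_ge n) (approximate lY lX m f'h)).
have [hr _] := hh; have [inh _] := lim_in_hom lX n1;
  have [iny _] := lim_in_hom lY m.
have aX := @admissible_any _ _ _ X; have aY := @admissible_any _ _ _ (M
  (lim_shape lY m)).
have usg := unit_system_map gr (unit_system_munit gA _).
(* [hc] controls h on diagonal units only, while g (e_v) need not be a sum of these. So g (e_v) is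
   replaced by an equivalent [vsum K], [hc] is applied to each summand, and f' f = 1 leads back to
   e_v. *)
have E (v : vertex (lim_shape lX n)) :
    eqv anyrel 0 (lim_in (h (g (videm v)))) (lim_in (lim_tr n1 (videm v))).
  rewrite lim_in_tr //; set p := g (videm v).
  have ip : idem anyrel p by exact: unit_system_idem usg.
  have [K [_ pK _]] := diagonalize A1 (mode_any fA) ip (vsum_full p).
  have inhr := graded_ring_hom_comp hr inh; have f'in :=
    graded_ring_hom_comp iny f'h.
  apply: (eqv_trans0 aX (eqv_any_map inhr pK)).
  apply: (@eqv_trans0 _ _ _ _ _ aX _ (f' (lim_in p))); last first.
    by rewrite -[X in eqv _ _ _ X]fK; apply: (eqv_any_map f'h); exact: gc.
  apply: (@eqv_trans0 _ _ _ _ _ aX _ (f' (lim_in (vsum K)))); last first.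
    exact: (eqv_any_map f'in (eqv_sym0 aY pK)).
  rewrite -[f' _]/((f' \o @lim_in _ lY m) _) /vsum !hom_sum // -!big_enum.
  have orthH (Z : galg gA) (k : M (lim_shape lY m) -> Z)
    (kr : graded_ring_hom k) v' w :
      v' != w -> orth (k (videm v')) (k (videm w)).
    by move=> vw; split; rewrite -(homM kr) videm_orth ?(hom0 kr) // eq_sym.
  apply: eqv_sum => //; first exact: enum_uniq.
  - by move=> v' w _ _; exact: orthH.
  - by move=> v' w _ _; exact: orthH.
  - by move=> w _; exact: hc.
have [n' [[nn' n1n'] Hn']] := eventually_witness (eventuallyI
  (eventuallyI (eventually_ge N) (eventually_ge n1))
  (eventually_all (fun v => lift_eqv (E v)))).
have th := lim_tr_hom lX n1n'.
have hgt := graded_alg_hom_comp gh (graded_alg_hom_comp hh th).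
have nle := leq_trans nn1 n1n'.
have [|||u [u' [U Uh]]] := conjugate fA A1 mS hgt (lim_tr_hom lX nle).
- by move=> x y xy; apply: lim_tr_sig => //; apply: hs; exact: gs.
- by move=> x y xy; exact: lim_tr_sig.
- move=> b i; apply: eqv_sym0; first by [].
  by have := Hn' (Tagged _ i); rewrite lim_tr_tr.
have [tr_r trZ] := th; have [_ hZ] := hh.
have aXn := @admissible_any _ _ _ (M (lim_shape lX n')).
exists n', (fun y => u ** lim_tr n' (h y) ** u'); split=> //.
- split; last by move=> a x; rewrite hZ trZ -gscaleAr -gscaleAl.
  split=> [x y|x y|k x hx].
  + by rewrite (homD hr) (homD tr_r) gmulDr gmulDl.
  + rewrite (homM hr) (homM tr_r) !gmulA -(gmulA _ u') (ep_yx U) -!gmulA.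
    by rewrite [in RHS](gmulA (vsum setT)) (proj1 (vsum_full _)).
  + have := ghomogM (ghomogM (ep_homl U) (hom_homog tr_r (hom_homog hr hx)))
    (ep_homr U).
    by rewrite oppr0 addr0 add0r.
split.
  move=> x y xy; rewrite -gmulA.
  apply: (adM (adm _)); first exact: ep_ad U.
  apply: (adM (adm _)); last by apply: (adC (adm _)); exact: ep_ad U.
  by apply: lim_tr_sig => //; exact: hs.
(* Correcting h by the unit u leaves the classes of idempotents unchanged. *)
move=> b i; apply: eqv_trans0 (hc b i) => //.
rewrite -(lim_in_tr _ n1n').
apply: eqv_any_map; first exact: (lim_in_hom lX n').1.
apply: (eqv_sym0 aXn).
have := eqv_pair_sym (adm _) U; rewrite oppr0 => U'.
have U1 : eqv_pair anyrel 0 (vsum setT) (vsum setT) u' u by case: U'.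
have ic : idem anyrel (lim_tr n' (h (munit i i))).
  exact: unit_system_idem (unit_system_map tr_r (unit_system_map hr
    (unit_system_munit gA _))).
by eexists; eexists; exact: (eqv_pair_restrict aXn U1 ic (vsum_full _)).
Qed.

(** * From commuting triangles to an isomorphism of the limits *)

Section Intertwining.
Variables (X Y : galg gA) (lX : limit_of X) (lY : limit_of Y).
Variables (f : X -> Y) (f' : Y -> X).
Hypotheses (fh : graded_ring_hom f) (f'h : graded_ring_hom f').
Hypotheses (fK : cancel f f') (f'K : cancel f' f).

Record stage := Stage {
  st_n : nat;
  st_m : nat;
  st_map : M (lim_shape lX st_n) -> M (lim_shape lY st_m);
  st_hom : graded_alg_hom st_map;
  st_sig : sig_preserving st_map;
  st_compatible : compatible f st_map
}.

Definition refines (s t : stage) : Prop :=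
  exists h : M (lim_shape lY (st_m s)) -> M (lim_shape lX (st_n t)),
    [/\ (st_n s < st_n t)%N, (st_m s < st_m t)%N,
        forall x, h (@st_map s x) = lim_tr _ x
      & forall y, @st_map t (h y) = lim_tr _ y].

Lemma refine s : exists t, refines s t.
Proof.
have [n [h [_ nn hg hh [hs hc]]]] :=
  half_step (st_n s).+1 f'h fK (@st_hom s) (@st_sig s) (@st_compatible s).
have [m [g [_ mm gh gH [gs gc]]]] := half_step (st_m s).+1 fh f'K hh hs hc.
by exists (Stage gH gs gc), h.
Qed.

Lemma stage0 : inhabited stage.
Proof.
have [m [g [gh gs gc]]] := eventually_witness (approximate lX lY 0 fh).
by split; exact: Stage gh gs gc.
Qed.

Lemma refining_sequence : exists c : nat -> stage, forall k, refines (c k)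
  (c k.+1).
Proof.
have [next nextP] := choice refine; have [s0] := stage0.
by exists (fun k => iter k next s0) => k; exact: nextP.
Qed.

(** psi is glued from the A-linear stage maps. The limits carry no [sig], so compatibility with the
    involution is expressed by representatives at finite stages. *)
Lemma intertwine : exists psi : X -> Y, [/\ bijective psi, graded_alg_hom psi
  & forall n (a b : M (lim_shape lX n)), sig _ a b ->
    exists m (a' b' : M (lim_shape lY m)),
    [/\ sig _ a' b', psi (lim_in a) = lim_in a' & psi (lim_in b) = lim_in b']].
Proof.
have [c cP] := refining_sequence.
pose n k := st_n (c k); pose m k := st_m (c k).
pose g k : M (lim_shape lX (n k)) -> M (lim_shape lY (m k)) := @st_map (c k).
have mono (u : nat -> nat) : (forall k, u k < u k.+1)%N ->
    (forall k l, k <= l -> u k <= u l)%N /\ (forall k, k <= u k)%N.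
  move=> uS; split.
    exact: (@homo_leq _ u leq leqnn (fun y x z => @leq_trans y x z)
      (fun k => ltnW (uS k))).
  by elim=> // k /leq_ltn_trans; apply.
have [nle nge] := mono n (fun k => let: ex_intro _ (And4 l _ _ _) := cP k in l).
have [mle mge] := mono m (fun k => let: ex_intro _ (And4 _ l _ _) := cP k in l).
have gtr k l (x : M (lim_shape lX (n k))) : (k <= l)%N ->
    g l (lim_tr _ x) = lim_tr _ (g k x).
  elim: l => [|l IH].
    by rewrite leqn0 => /eqP k0; subst k; rewrite !lim_tr_id.
  rewrite leq_eqVlt => /predU1P[e|]; first by subst k; rewrite !lim_tr_id.
  rewrite ltnS => kl; have [h [_ _ hg gh]] := cP l.
  rewrite -(lim_tr_tr x (nle _ _ kl) (nle _ _ (leqnSn l))) -hg {1}/g gh.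
  rewrite -[st_map _]/(g l _) IH //.
  by rewrite lim_tr_tr // mle.
have repX j x : exists k (a : M (lim_shape lX (n k))),
  (j <= k)%N /\ x = lim_in a.
  have [i [a ->]] := lim_surj lX x; exists (maxn i j).
  have le : (i <= n (maxn i j))%N by apply: leq_trans (nge _); rewrite leq_maxl.
  by exists (lim_tr _ a); rewrite lim_in_tr // leq_maxr.
pose graph x y := exists k a, x = lim_in a /\ y = lim_in (g k a).
have graphP x : exists y, graph x y.
  by have [k [a [_ ->]]] := repX 0%N x; exists (lim_in (g k a)), k, a.
have g_eq k l a b : @lim_in _ lX (n k) a = @lim_in _ lX (n l) b ->
    lim_in (g k a) = lim_in (g l b).
  move=> /lim_ev2[N HN]; have [p [[kp lp] Np]] :=
    eventually_witness (eventuallyI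
    (eventuallyI (eventually_ge k) (eventually_ge l)) (eventually_ge N)).
  rewrite -(lim_in_tr _ (mle _ _ kp)) -(lim_in_tr _ (mle _ _ lp)) -!gtr //.
  by rewrite HN // (leq_trans Np).
(* The map h of the first triangle is a left inverse of g p up to a connecting map. *)
have g_inj k l a b : lim_in (g k a) = lim_in (g l b) ->
    @lim_in _ lX (n k) a = @lim_in _ lX (n l) b.
  move=> /lim_ev2[N HN]; have [p [[kp lp] Np]] :=
    eventually_witness (eventuallyI
    (eventuallyI (eventually_ge k) (eventually_ge l)) (eventually_ge N)).
  have := HN (m p) (leq_trans Np (mge _)); rewrite -!gtr //.
  have [h [_ _ hg _]] := cP p => /(congr1 h); rewrite /g !hg => e.
  rewrite -(lim_in_tr _ (nle _ _ kp)) -(lim_in_tr _ (nle _ _ lp)).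
  rewrite -[LHS](lim_in_tr _ (nle _ _ (leqnSn p))).
  rewrite -[RHS](lim_in_tr _ (nle _ _ (leqnSn p))).
  exact: congr1 _ e.
have [psi psiP] := choice graphP.
have psiE k a : psi (lim_in a) = lim_in (g k a).
  by have [l [b [e ->]]] := psiP (lim_in a); exact: g_eq.
have repX2 x y : exists k (a b : M (lim_shape lX (n k))),
  x = lim_in a /\ y = lim_in b.
  have [k [a [_ ->]]] := repX 0%N x; have [l [b [kl ->]]] := repX k y.
  by exists l, (lim_tr _ a), b; rewrite lim_in_tr // nle.
have psi_inj : injective psi.
  by move=> x y; have [k [a [b [-> ->]]]] := repX2 x y; rewrite !psiE => /g_inj.
(* The second triangle: g h is a connecting map. An element of stage i is first moved to stage m i,
   which is possible because i <= m i. *)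
have psi_surj y : exists x, psi x = y.
  have [i [a ->]] := lim_surj lY y; have [h [_ _ _ gh]] := cP i.
  exists (lim_in (h (lim_tr _ a))); rewrite (psiE i.+1) /g gh.
  by rewrite !lim_in_tr ?mge ?mle.
exists psi; split.
- have [psi' psi'K] := choice psi_surj.
  by exists psi' => // x; apply: psi_inj; rewrite psi'K.
- split=> [|a x]; last first.
    have [k [b [_ ->]]] := repX 0%N x; rewrite psiE -(lim_in_hom lX _).2 psiE.
    by rewrite /g (st_hom (c k)).2 (lim_in_hom lY _).2.
  split=> [x y|x y|i x hx].
  + have [k [a [b [-> ->]]]] := repX2 x y; rewrite !psiE.
    by rewrite -(homD (lim_in_hom lX _).1) psiE /g (homD (st_hom (c k)).1)
      (homD (lim_in_hom lY _).1).
  + have [k [a [b [-> ->]]]] := repX2 x y; rewrite !psiE.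
    by rewrite -(homM (lim_in_hom lX _).1) psiE /g (homM (st_hom (c k)).1)
      (homM (lim_in_hom lY _).1).
  + have [k [a [ha ->]]] := lim_lift lX hx; rewrite -(lim_in_tr _ (nge k)) psiE.
    apply: (hom_homog (lim_in_hom lY _).1); apply: (hom_homog (st_hom (c k)).1).
    exact: (hom_homog (lim_tr_hom lX (nge k)).1).
- move=> k a b ab; exists (m k), (g k (lim_tr _ a)), (g k (lim_tr _ b)).
  rewrite -(lim_in_tr a (nge k)) -(lim_in_tr b (nge k)) !psiE; split=> //.
  by apply: st_sig; apply: lim_tr_sig.
Qed.

End Intertwining.
End Limits.

(** * Pivots with involution *)

Section StarMode.
Variables (G : zmodType) (A : comPzRingType) (gA : ring_grading G A).
Variable sA : ring_involution gA.

Local Notation M s := (matricial gA s).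
Local Notation munit := (@munit _ _ gA _ _).
Local Notation videm := (@videm _ _ gA _).

Lemma rstar1 : sA 1 = 1.
Proof. by rewrite -[LHS]mulr1 -{2}(rstarK sA 1) -rstarM mulr1 rstarK. Qed.

Lemma rstarN a : sA (- a) = - sA a.
Proof. by apply/eqP; rewrite -addr_eq0 -rstarD addNr rstar0. Qed.

Lemma rstar_eq0 a : sA a = 0 -> a = 0.
Proof. by move=> e; rewrite -[a](rstarK sA) e rstar0. Qed.

Definition mstar s (x : M s) : M s := gstar (x : matricial_star sA s).

Definition star_family : relation_family gA := fun s x y => y = mstar x.

Lemma mstarK s : involutive (@mstar s).
Proof. exact: (@gstarK _ _ _ _ (matricial_star sA s)). Qed.
Lemma mstarD s : {morph @mstar s : x y / x + y}.
Proof. exact: (@gstarD _ _ _ _ (matricial_star sA s)). Qed.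
Lemma mstarM s (x y : M s) : mstar (x ** y) = mstar y ** mstar x.
Proof. exact: (@gstarM _ _ _ _ (matricial_star sA s)). Qed.
Lemma mstarZ s a (x : M s) : mstar (a *: x) = sA a *: mstar x.
Proof. exact: (@gstarZ _ _ _ _ (matricial_star sA s)). Qed.
Lemma mstar0 s : mstar (0 : M s) = 0.
Proof. by apply: (addrI (mstar (0 : M s))); rewrite -mstarD !addr0. Qed.
Lemma mstarN s (x : M s) : mstar (- x) = - mstar x.
Proof. by apply/eqP; rewrite -addr_eq0 -mstarD addNr mstar0. Qed.
Lemma mstarB s (x y : M s) : mstar (x - y) = mstar x - mstar y.
Proof. by rewrite mstarD mstarN. Qed.

Lemma entry_mstar s (x : M s) b (i j : 'I_(msize b)) :
  entry (mstar x) i j = sA (entry x j i).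
Proof. by rewrite /entry /mstar /gstar /= /dsum_star ffunE mxE. Qed.

Lemma mstar_munit s b (i j : 'I_(@msize _ s b)) : mstar (munit i j) = munit j i.
Proof.
apply: entry_ext => c k l; rewrite entry_mstar.
case: (b =P c) => [e|ne]; last by rewrite !entry_munit_neq ?rstar0.
subst c; rewrite !entry_munit [in RHS]andbC.
by case: (_ && _); rewrite ?rstar0 ?rstar1.
Qed.

Lemma mstar_videm s (v : vertex s) : mstar (videm v) = videm v.
Proof. exact: mstar_munit. Qed.

Lemma star_admissible s : admissible (@star_family s).
Proof.
split; rewrite /star_family.
- by rewrite mstar0.
- by move=> x _ y _ -> ->; rewrite mstarD.
- by move=> x _ ->; rewrite mstarN.
- by move=> x _ y _ -> ->; rewrite mstarM.
- by move=> x _ ->; rewrite mstarK.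
Qed.

Hypothesis fA : graded_field gA.
Hypothesis A1 : (1 : A) <> 0.
Hypothesis uA : enough_unitaries sA.
Hypothesis pA : two_proper_on sA (gA 0).
Hypothesis yA : star_pythagorean_on sA (gA 0).

(** Entries of a row have different degrees, while the hypotheses on norms concern degree 0.
    Multiplying x_i by w* for a unitary w of its degree moves it to degree 0 without changing x_i
    x_i*. *)
Lemma sum_norms (I : eqType) (r : seq I) (x : I -> A) (d : I -> G) :
  (forall i, gA (d i) (x i)) ->
  exists c, [/\ gA 0 c, \sum_(i <- r) x i * sA (x i) = c * sA c
    & c = 0 -> {in r, forall i, x i = 0}].
Proof.
move=> hx; elim: r => [|i r [c [hc e c0]]].
  by exists 0; rewrite big_nil mul0r; split=> //; exact: homog0.
have [z [hz ez z0]] : exists z, [/\ gA 0 z, x i * sA (x i) = z * sA z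
    & z = 0 -> x i = 0].
  case: (pselect (x i = 0)) => [xi0|nz].
    by exists 0; rewrite xi0 !mul0r; split=> //; exact: homog0.
  have [|w [hw w1 w2]] := uA (g := d i); first by exists (x i).
  exists (x i * sA w); split.
  - by have := rg_homogM (hx i) (rstar_homog sA hw); rewrite subrr.
  - by rewrite rstarM rstarK -mulrA (mulrA (sA w)) w2 mul1r.
  - by move=> e0; rewrite -[x i]mulr1 -w2 mulrA e0 mul0r.
have [k hk ek] := yA hz hc.
exists k; split=> //; first by rewrite big_cons ez e ek.
move=> k0; have [] := pA hz hc _; first by rewrite ek k0 mul0r.
move=> /z0 xi0 /c0 xr j; rewrite inE => /predU1P[-> //|]; exact: xr.
Qed.

Lemma scale_videm_eq0 s (v : vertex s) a : a *: videm v = 0 -> a = 0.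
Proof.
move=> /(congr1 (fun x => entry x (tagged v) (tagged v))).
by rewrite entryZ entry_munit entry0 !eqxx mulr1.
Qed.

(** z is supported on the row of v, so z z* is the sum of the norms of the entries of that row. *)
Lemma row_norm s (v : vertex s) (z : M s) :
  ghomog (M s) 0 z -> videm v ** z = z ->
  exists c, [/\ gA 0 c, z ** mstar z = (c * sA c) *: videm v & c = 0 -> z = 0].
Proof.
case: v => b j hz vz.
have [c [hc ec c0]] := sum_norms (index_enum _) (fun k => homog_entry j k hz).
exists c; split=> // [|/c0 z0].
  rewrite -vz mstarM mstar_videm gmulA -(gmulA (videm _)) [LHS]munit_corner.
  rewrite entryM -ec; congr (_ *: _); apply: eq_bigr => k _.
  by rewrite entry_mstar.
have [_ <-] := vsum_full z; rewrite /vsum gmul_sumr big1 // => -[b' k] _.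
rewrite -vz; case: (b =P b') => [e|ne]; last exact: munitM_neq.
subst b'; rewrite [LHS]munit_corner.
have -> : entry z j k = 0 by apply: z0; rewrite mem_index_enum.
by rewrite scale0r.
Qed.

(* For b = a* and y = x* the hypothesis on x, y, beta says that the
   quasi-reflection f - x a a* is unitary; unlike for reflections, x need not
   be real, so that no square root of a positive element is needed. *)
Lemma reflectionM s (f e a b : M s) (x y beta : A) :
  f ** f = f -> f ** a = a -> b ** f = b -> a ** e = a ->
  b ** a = beta *: e -> x + y = x * y * beta ->
  (f - x *: (a ** b)) ** (f - y *: (a ** b)) = f.
Proof.
move=> ff fa bf ae ba xy.
have PP : (a ** b) ** (a ** b) = beta *: (a ** b).
  by rewrite gmulA -(gmulA a) ba -gscaleAr ae -gscaleAl.
rewrite gmulBl !gmulBr ff -!gscaleAl -!gscaleAr PP gmulA fa -gmulA bf !scalerA.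
by rewrite -xy scalerDl opprB [x *: _ + _]addrC addrK subrK.
Qed.

(** A nonzero corner of degree d shows that the component of A for this matrix position is nonzero;
    a unitary u of that component makes u e_ij a partial isometry. *)
Lemma star_connect s d (v w : vertex s) :
  eqv anyrel d (videm v) (videm w) -> eqv (@star_family s) d (videm v)
    (videm w).
Proof.
move=> [x [y [_ hx hy xy yx px py]]].
have nz : videm v ** x ** videm w <> 0.
  rewrite px -yx gmulA xy px => x0.
  by apply: (videm_neq0 (gA := gA) A1 (v := v)); rewrite -xy x0 gmul0r.
have [b [i [j [ev ew e]]]] := vertex_corner_nz nz; subst v w.
have [|u [hu u1 u2]] := uA (g := d + mshift j - mshift i).
  exists (entry x i j); split; first exact: homog_entry.
  by move=> e0; apply: nz; rewrite e e0 scale0r.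
exists (u *: munit i j), (mstar (u *: munit i j)); rewrite mstarZ mstar_munit.
split=> //.
- by rewrite /star_family mstarZ mstar_munit.
- by have := ghomogZ hu (munit_homog gA i j); rewrite addrA subrK addrK.
- have := ghomogZ (rstar_homog sA hu) (munit_homog gA j i).
  by rewrite opprB addrC addrA subrK opprD addrC subrK.
- by rewrite -gscaleAl -gscaleAr scalerA u1 scale1r munitM.
- by rewrite -gscaleAl -gscaleAr scalerA u2 scale1r munitM.
- by rewrite -gscaleAr munitM.
- by rewrite -gscaleAr munitM.
Qed.

Lemma star_pivot s (p f : M s) (v : vertex s) :
  idem (@star_family s) p -> idem (@star_family s) f ->
  below p f -> below (videm v) f -> videm v ** p ** videm v <> 0 ->
  exists u u', eqv_pair (@star_family s) 0 f f u u' /\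
    below (u' ** videm v ** u) p.
Proof.
move=> [ps hp pp] iF [fp pf] [fe ef] nz; set e := videm v in fe ef nz *.
have [fs hf ff] := iF.
have ee : e ** e = e by exact: videmK.
have he : ghomog (M s) 0 e by exact: videm_homog.
have es : mstar e = e by exact: mstar_videm.
have h2 x y : ghomog (M s) 0 x -> ghomog (M s) 0 y -> ghomog (M s) 0 (x ** y).
  by move=> hx hy; rewrite -[0]addr0; exact: ghomogM.
have hZ a x : gA 0 a -> ghomog (M s) 0 x -> ghomog (M s) 0 (a *: x).
  by move=> ha hx; rewrite -[0]addr0; exact: ghomogZ.
(* As p is a projection, e p e = (e p)(e p)* is the norm of a row, hence c c* e. *)
have [|c [hc ec _]] := row_norm (v := v) (h2 _ _ he hp);
  first by rewrite -/e gmulA ee.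
rewrite mstarM es -ps gmulA -(gmulA e p p) pp -/e in ec.
have c0 : c <> 0 by move=> c0; apply: nz; rewrite ec c0 mul0r scale0r.
have [i hi ci] := homog_inverse fA hc c0; rewrite oppr0 in hi.
have si : sA i * sA c = 1 by rewrite -rstarM ci rstar1.
have his : gA 0 (sA i) by have := rstar_homog sA hi; rewrite oppr0.
(* For c = 1 the row e p - e has norm e - e p e = 0, hence e p = e: already e lies below p and u = f
   will do. *)
case: (pselect (c = 1)) => [c1|c1].
  have epe : e ** p = e.
    have hb : ghomog (M s) 0 (e ** p - e) by apply: homogB => //; exact: h2.
    have [|k [hk ek k0]] := row_norm (v := v) hb;
      first by rewrite -/e gmulBr gmulA ee.
    apply/eqP; rewrite -subr_eq0; apply/eqP/k0.
    apply: contrapT => kn0; have [l _ kl] := homog_inverse fA hk kn0.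
    apply: kn0; apply: rstar_eq0.
    have : k * sA k = 0.
      apply: (@scale_videm_eq0 s v); rewrite -ek mstarB mstarM -ps es.
      rewrite gmulBl !gmulBr !gmulA -(gmulA e p p)
        pp ee ec c1 rstar1 mulr1 scale1r.
      by rewrite !subrr.
    by move=> kk; rewrite -[LHS]mul1r -kl mulrAC kk mul0r.
  have pe : p ** e = e by have := congr1 (@mstar s) epe; rewrite mstarM -ps es.
  exists f, f; split; first exact: eqv_pair_refl iF.
  by rewrite fe ef.
have n1 : 1 - c <> 0 by move=> /eqP; rewrite subr_eq0 => /eqP /esym.
have h1c : gA 0 (1 - c) by apply: homogB => //; exact: homog1.
(* This coefficient makes u w = e: below, b w = (1 - c) e, hence u w = w - t (1 - c) a = w - a =
   e. *)
have [t ht ct] := homog_inverse fA h1c n1; rewrite oppr0 in ht.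
have st : (1 - sA c) * sA t = 1.
  by rewrite -[1 in LHS]rstar1 -rstarN -rstarD -rstarM mulrC ct rstar1.
(* e p e = c c* makes w = c*^-1 p e a partial isometry from e onto an idempotent
   below p, and the quasi-reflection u moves w to e; it degenerates if c = 1. *)
pose y := i *: (e ** p); pose w := sA i *: (p ** e).
have ys : mstar y = w by rewrite mstarZ mstarM -ps es.
have ws : mstar w = y by rewrite -ys mstarK.
have yw : y ** w = e.
  rewrite /y /w -gscaleAl -gscaleAr gmulA -(gmulA e p p) pp ec !scalerA.
  by rewrite mulrACA (mulrC i) ci si mulr1 scale1r.
have ye : y ** e = sA c *: e.
  by rewrite /y -gscaleAl ec scalerA mulrA [i * c]mulrC ci mul1r.
have ew : e ** w = c *: e.
  by rewrite /w -gscaleAr gmulA ec scalerA mulrCA si mulr1.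
pose b := y - e; pose a := w - e.
have asb : mstar a = b by rewrite mstarB ws es.
have bs : mstar b = a by rewrite mstarB ys es.
have fa : f ** a = a by rewrite gmulBr fe /w -gscaleAr gmulA fp.
have bf : b ** f = b by rewrite gmulBl ef /y -gscaleAl -gmulA pf.
have ae : a ** e = a by rewrite gmulBl ee /w -gscaleAl -gmulA ee.
have ba : b ** a = ((1 - c) + (1 - sA c)) *: e.
  rewrite gmulBl !gmulBr yw ye ew ee !scalerDl !scaleNr !scale1r opprB.
  by rewrite addrC.
have hab : ghomog (M s) 0 (a ** b).
  have hy : ghomog (M s) 0 y by apply: hZ => //; exact: h2.
  have hw : ghomog (M s) 0 w by apply: hZ => //; exact: h2.
  by apply: h2; apply: homogB.
pose u := f - t *: (a ** b); pose u' := f - sA t *: (a ** b).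
have abs : mstar (a ** b) = a ** b by rewrite mstarM asb bs.
have tt : t + sA t = t * sA t * ((1 - c) + (1 - sA c)).
  by rewrite mulrDr mulrAC (mulrC t (1 - c)) ct mul1r -mulrA (mulrC (sA t))
    st mulr1 addrC.
have uu' : u ** u' = f by apply: reflectionM ae ba tt.
have u'u : u' ** u = f.
  by apply: reflectionM ae ba _ => //; rewrite addrC tt [sA t * t]mulrC.
have H : eqv_pair (@star_family s) 0 f f u u'.
  split=> //.
  - by rewrite /star_family mstarB -fs mstarZ abs.
  - by apply: homogB => //; exact: hZ.
  - rewrite oppr0; apply: homogB => //; apply: hZ => //.
    by have := rstar_homog sA ht; rewrite oppr0.
  - by rewrite gmulBr ff -gscaleAr gmulA fa.
  - by rewrite gmulBr ff -gscaleAr gmulA fa.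
exists u, u'; split=> //.
have uw : u ** w = e.
  have bw : b ** w = (1 - c) *: e by rewrite gmulBl yw ew scalerBl scale1r.
  have fw : f ** w = w by rewrite /w -gscaleAr gmulA fp.
  rewrite gmulBl fw -gscaleAl -gmulA bw -[a ** _]gscaleAr ae scalerA mulrC ct
    scale1r.
  by rewrite opprB addrC subrK.
have u'e : u' ** e = w by rewrite -uw gmulA u'u /w -gscaleAr gmulA fp.
have eu : e ** u = y.
  by rewrite -ws -u'e mstarM es; congr (_ ** _);
    rewrite mstarB -fs mstarZ abs rstarK.
rewrite -ee gmulA u'e -gmulA eu /w /y.
split; rewrite ?gmulA -?gscaleAr -?gscaleAl ?gmulA ?pp //.
by rewrite -gmulA pp.
Qed.

Lemma star_extend s t (g : M s -> M t) : graded_alg_hom g ->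
  (forall b (i j : 'I_(@msize _ s b)), star_family (g (munit i j))
    (g (munit j i))) ->
  forall x y, star_family x y -> star_family (g x) (g y).
Proof.
move=> [gr gZ] gs x _ ->; rewrite /star_family -[LHS]mstarK; congr mstar.
apply/esym/(alg_hom_ext (f := g) (g := fun x => mstar (g (mstar x)))).
- exact: homD gr.
- exact: gZ.
- by move=> y z; rewrite mstarD (homD gr) mstarD.
- by move=> a y; rewrite mstarZ gZ mstarZ rstarK.
- by move=> b i j; rewrite mstar_munit -gs.
Qed.

Lemma mode_star : mode star_family.
Proof.
split; [exact: star_admissible| |exact: star_connect|exact: star_pivot|exact:
  star_extend].
by move=> s b i j; rewrite /star_family mstar_munit.
Qed.

End StarMode.

(** * Direct limits *)

Section DirectLimits.
Variables (G : zmodType) (A : comPzRingType) (gA : ring_grading G A).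

Local Notation M s := (matricial gA s).

Section LimitOfDirlim.
Variables (sig : relation_family gA) (s : nat -> mshape G).
Arguments sig : clear implicits.
Variables (f : forall n, M (s n) -> M (s n.+1))
  (hf : forall n, graded_alg_hom (@f n)).
Hypothesis sf : forall n x y, sig _ x y -> sig _ (@f n x) (@f n y).

Let D := @DirSeq G A gA (fun n => M (s n)) f hf.

Lemma dirlim_in_hom n : @graded_alg_hom _ _ _ (M (s n)) (dirlim D)
  (@dl_in _ _ _ D n).
Proof.
split=> [|a x]; last by rewrite dl_inZ.
split=> [x y|x y|g x hx]; [exact: dl_inD|by rewrite [RHS]dl_mulE|by exists n,
  x].
Qed.

Lemma dirseq_trans_hom n m : (n <= m)%N ->
  @graded_alg_hom _ _ _ (M (s n)) (M (s m)) (@ds_trans _ _ _ D n m).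
Proof.
move=> nm; split; last exact: (ds_transZ (D := D) nm).
split; [exact: (ds_transD (D := D) nm)|exact: (ds_transM (D := D) nm)|].
exact: (ds_transh (D := D) nm).
Qed.

Lemma dirseq_trans_sig n m (x y : M (s n)) : (n <= m)%N -> sig _ x y ->
  sig _ (@ds_trans _ _ _ D n m x) (@ds_trans _ _ _ D n m y).
Proof.
move=> nm xy; elim: m nm => [|m IH].
  by rewrite leqn0 => /eqP n0; subst n; rewrite !ds_trans_id.
rewrite leq_eqVlt => /predU1P[e|]; first by subst n; rewrite !ds_trans_id.
by rewrite ltnS => nm; rewrite !ds_transS //; apply: sf; exact: IH.
Qed.

Lemma dirlim_eq n (x y : M (s n)) :
  @dl_in _ _ _ D n x = @dl_in _ _ _ D n y ->
  exists2 m, (n <= m)%N & @ds_trans _ _ _ D n m x = @ds_trans _ _ _ D n m y.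
Proof. by move=> /dl_in_eq[m [nm _ e]]; exists m. Qed.

Lemma dirlim_lift g (x : dirlim D) : ghomog (dirlim D) g x ->
  exists n (a : M (s n)), ghomog _ g a /\ x = @dl_in _ _ _ D n a.
Proof. by move=> [n [a ha ->]]; exists n, a. Qed.

Definition limit_of_dirlim : limit_of sig (dirlim D) :=
  @LimitOf _ _ _ sig (dirlim D) s (@dl_in _ _ _ D) (@ds_trans _ _ _ D)
    dirlim_in_hom dirseq_trans_hom dirseq_trans_sig
    (fun n m x nm => dl_in_trans (D := D) x nm) (@ds_trans_id _ _ _ D)
    (fun n m p x nm mp => ds_trans_trans (D := D) x nm mp)
    (@dl_inP _ _ _ D) dirlim_lift dirlim_eq.

End LimitOfDirlim.
End DirectLimits.

(** * The two halves of the theorem *)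

Section Isomorphisms.
Variables (G : zmodType) (A : comPzRingType) (gA : ring_grading G A).
Hypothesis fA : graded_field gA.
Hypothesis A1 : (1 : A) <> 0.

Lemma limit_isomorphism (sig : relation_family gA) (R S X Y : galg gA)
    (lX : limit_of sig X) (lY : limit_of sig Y) (a : R -> X) (b : S -> Y) :
  mode sig -> bijective a -> graded_alg_hom a -> bijective b -> graded_alg_hom
    b ->
  graded_ring_isomorphic R S ->
  exists psi : X -> Y, exists2 b' : Y -> S,
    [/\ bijective psi, graded_alg_hom psi
      & forall n (x y : matricial gA (lim_shape lX n)), sig _ x y ->
        exists m (x' y' : matricial gA (lim_shape lY m)),
        [/\ sig _ x' y', psi (lim_in x) = lim_in x'
          & psi (lim_in y) = lim_in y']]
    & [/\ cancel b b', cancel b' b & graded_alg_hom b'].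
Proof.
move=> mS [a' aK a'K] ha [b' bK b'K] hb [f [f' fK f'K] hf].
have [ar _] := ha; have [br _] := hb.
have ha' := graded_alg_hom_inv aK a'K ha; have hb' :=
  graded_alg_hom_inv bK b'K hb.
have [a'r _] := ha'; have [b'r _] := hb'.
have hf' := graded_ring_hom_inv fK f'K hf.
have hF := graded_ring_hom_comp a'r (graded_ring_hom_comp hf br).
have hF' := graded_ring_hom_comp b'r (graded_ring_hom_comp hf' ar).
have [|| psi Hpsi] := intertwine fA A1 mS lX lY hF hF'.
- by move=> x /=; rewrite bK fK a'K.
- by move=> x /=; rewrite aK f'K b'K.
by exists psi, b'.
Qed.

End Isomorphisms.

Lemma zero_ring_lmod (A : comPzRingType) (V : lmodType A) (x : V) :
  (1 : A) = 0 -> x = 0.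
Proof. by move=> e; rewrite -[x]scale1r e scale0r. Qed.

Lemma graded_ring_isomorphicW (G : zmodType) (A : comPzRingType)
    (gA : ring_grading G A) (R S : galg gA) :
  graded_alg_isomorphic R S -> graded_ring_isomorphic R S.
Proof. by move=> [f fb [fr _]]; exists f. Qed.

Section Theorems.
Variables (G : zmodType) (A : comPzRingType) (gA : ring_grading G A).
Hypothesis fA : graded_field gA.

Lemma ultramatricial_isomorphic (R S : galg gA) :
  ultramatricial R -> ultramatricial S ->
  graded_ring_isomorphic R S -> graded_alg_isomorphic R S.
Proof.
move=> [s [f [hf [a ab ah]]]] [t [g [hg [b bb bh]]]] RS.
(* The zero ring is a graded field in the sense of [graded_field]. *)
case: (pselect ((1 : A) = 0)) => [z|A1].
  have [h hb hr] := RS; exists h => //; split=> // c x.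
  by rewrite (zero_ring_lmod (h _) z) [RHS](zero_ring_lmod _ z).
have lX := limit_of_dirlim (sig := fun s => @anyrel _ _ _ (matricial gA s))
  hf (fun _ _ _ => id).
have lY := limit_of_dirlim (sig := fun s => @anyrel _ _ _ (matricial gA s))
  hg (fun _ _ _ => id).
have [psi [b' [pb ph _] [bK b'K b'h]]] :=
  limit_isomorphism fA A1 lX lY (mode_any fA) ab ah bb bh RS.
exists (b' \o (psi \o a)).
  by apply: bij_comp; [exists b|exact: bij_comp].
by apply: graded_alg_hom_comp b'h; exact: graded_alg_hom_comp.
Qed.

Variable sA : ring_involution gA.
Hypotheses (uA : enough_unitaries sA) (pA : two_proper_on sA (gA 0)).
Hypothesis yA : star_pythagorean_on sA (gA 0).

Lemma ultramatricial_star_isomorphic (R S : gsalg sA) :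
  ultramatricial_star R -> ultramatricial_star S ->
  graded_ring_isomorphic R S -> graded_star_alg_isomorphic R S.
Proof.
move=> [s [f [hf [a ab [ah ast]]]]] [t [g [hg [b bb [bh bst]]]]] RS.
case: (pselect ((1 : A) = 0)) => [z|A1].
  have [h hb hr] := RS; exists h => //; split; first split=> // c x.
    by rewrite (zero_ring_lmod (h _) z) [RHS](zero_ring_lmod _ z).
  by move=> x; rewrite (zero_ring_lmod (h _) z) [RHS](zero_ring_lmod _ z).
have sf n (x y : matricial gA (s n)) :
    star_family sA x y -> star_family sA (f n x : matricial gA (s n.+1))
      (f n y).
  by rewrite /star_family => ->; exact: (hf n).2.
have sg n (x y : matricial gA (t n)) :
    star_family sA x y -> star_family sA (g n x : matricial gA (t n.+1))
      (g n y).
  by rewrite /star_family => ->; exact: (hg n).2.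
(* Kept transparent, because the check of the involution below identifies the stages of these limits
   with those of the given sequences. *)
pose lX := limit_of_dirlim (fun n => (hf n).1) sf.
pose lY := limit_of_dirlim (fun n => (hg n).1) sg.
have [psi [b' [pb ph ps] [bK b'K b'h]]] :=
  limit_isomorphism fA A1 lX lY (mode_star fA A1 uA pA yA) ab ah bb bh RS.
exists (b' \o (psi \o a)).
  by apply: bij_comp; [exists b|exact: bij_comp].
split; first by apply: graded_alg_hom_comp b'h; exact: graded_alg_hom_comp.
(* The involution is checked on a representative x0 of a x: x0 and its adjoint are a related pair,
   so psi sends them to the classes of some x' and of its adjoint. *)
move=> x /=; apply: (can_inj bK); rewrite bst !b'K ast.
have [n [x0 ->]] := dl_inP (a x).
rewrite [gstar _](dl_starE x0).
have [m [x' [y' [e ex ey]]]] := ps n x0 (mstar sA x0) erefl.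
rewrite [LHS]ey [X in gstar X]ex e.
exact: esym (@dl_starE _ _ _ _ (StarDirSeq hg) m x').
Qed.

End Theorems.

Theorem corollary5p6 :
  (forall (G : zmodType) (A : comPzRingType) (gA : ring_grading G A)
      (sA : ring_involution gA),
    graded_field gA ->
    enough_unitaries sA ->
    two_proper_on sA (gA 0) ->
    star_pythagorean_on sA (gA 0) ->
    forall R S : gsalg sA,
      ultramatricial_star R -> ultramatricial_star S ->
      graded_ring_isomorphic R S <-> graded_star_alg_isomorphic R S)
  /\
  (forall (G : zmodType) (A : comPzRingType) (gA : ring_grading G A),
    graded_field gA ->
    forall R S : galg gA,
      ultramatricial R -> ultramatricial S ->
      graded_ring_isomorphic R S <-> graded_alg_isomorphic R S).
Proof.
split=> [G A gA sA fA uA pA yA R S uR uS|G A gA fA R S uR uS]; split.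
- exact: ultramatricial_star_isomorphic.
- by move=> [f fb [fh _]]; apply: graded_ring_isomorphicW; exists f.
- exact: ultramatricial_isomorphic.
- exact: graded_ring_isomorphicW.
Qed.
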